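(* Assume that there exists a measurable function $f\colon \mathbb{R}^d\to\mathbb{R}$ such that $$g(x)=\int_{\mathbb{R}^d} f(y)\,G_r(x,dy)\quad\text{for all }x\in\mathbb{R}^d .$$ Let $S\subseteq\mathbb{R}^d$ be a Borel set such that $f(x)\ge 0$ for all $x\in S$. Assume that $\widetilde V\colon\mathbb{R}^d\to\mathbb{R}$ defined by $$\widetilde V(x):=\int_S f(y)\,G_r(x,dy)$$ satisfies the following two conditions: (1) $\widetilde V(x)\ge g(x)$ for all $x\in\mathbb{R}^d\setminus S$; (2) $\widetilde V(x)=g(x)$ for all $x\in\partial S$, or equivalently $\int_{S^c} f(y)\,G_r(x,dy)=0$ for all $x\in\partial S$. Then $\tau^*=h_S$ is an optimal stopping time and $\widetilde V$ is the value function of the optimal stopping problem, i.e. $\widetilde V(x)=V(x)=\mathbf{E}_x\big(e^{-rh_S}g(X_{h_S})\big)$ for all $x\in\mathbb{R}^d$.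
   Context: $X=\{X_t\}_{t\ge0}$ is a multidimensional diffusion: a homogeneous nonterminating strong Markov process with continuous trajectories and values in $\mathbb{R}^d$, satisfying the Feller property, with its usual (completed, right-continuous) filtration $\mathbb{F}=\{\mathcal{F}_t\}_{t\geq 0}$, so that hitting times of Borel sets are stopping times. $\mathbf{P}_x$, $\mathbf{E}_x$ denote probability and expectation given $X_0=x$. The discount rate $r>0$ is fixed and $g\colon\mathbb{R}^d\to[0,\infty)$ is a continuous reward function. The optimal stopping problem has value function $$V(x)=\sup_\tau \mathbf{E}_x\big(e^{-r\tau}g(X_\tau)\big),$$ the supremum being over all $\mathbb{F}$-stopping times; a stopping time $\tau^*$ is optimal if it attains the supremum for every $x$. On $\{\tau=\infty\}$ one sets $e^{-r\tau}g(X_\tau):=\limsup_{t\to\infty}e^{-rt}g(X_t)$. The $r$-Green kernel is the measure $G_r(x,H):=\int_0^\infty e^{-rt}\,\mathbf{P}_x(X_t\in H)\,dt$, $H\subseteq\mathbb{R}^d$ Borel. Integrals against $G_r(x,dy)$ are understood to be absolutely convergent. For a Borel set $S$, $h_S:=\inf\{t\ge0: X_t\in S\}$ (with $\inf\emptyset=\infty$), $S^c=\mathbb{R}^d\setminus S$, and $\partial S$ is the topological boundary. *)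

(* Defs.v *)
From HB Require Import structures.
From mathcomp Require Import all_boot all_order all_algebra.
From mathcomp Require Import all_classical all_reals all_analysis.
From mathcomp Require Import measurable_realfun.

Set Implicit Arguments.
Unset Strict Implicit.
Unset Printing Implicit Defensive.

Import Order.TTheory GRing.Theory Num.Theory.
Import numFieldNormedType.Exports.

Local Open Scope classical_set_scope.
Local Open Scope ring_scope.

(* R^d with its usual topology and its Borel sigma-algebra, which the library
   does not put on row vectors. *)
Definition euclid (R : realType) (d : nat) : Type := 'rV[R]_d.

HB.instance Definition _ (R : realType) (d : nat) :=
  NormedModule.copy (euclid R d) 'rV[R]_d.
HB.instance Definition _ (R : realType) (d : nat) :=
  @isMeasurable.Build (sigma_display (@open 'rV[R]_d)) (euclid R d)
    <<s @open 'rV[R]_d >> (@sigma_algebra0 _ setT _) (@sigma_algebraC _ _)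
    (@sigma_algebra_bigcup _ setT _).

Definition boundary (T : topologicalType) (S : set T) : set T :=
  closure S `\` interior S.

Section Diffusion.
Context (R : realType) (d : nat).
Context (dO : measure_display) (Omega : measurableType dO).
(* Time is real, and only X t with 0 <= t is ever used. *)
Variable X : R -> Omega -> euclid R d.
Variable P : euclid R d -> probability Omega R.

(* sigma(X_s : s in T) *)
Definition natural (T : set R) : set (set Omega) :=
  <<s \bigcup_(s in T) preimage_set_system setT (X s) measurable >>.

(* Subsets of P_mu-null events of sigma(X_s : 0 <= s), where P_mu is the law
   of X with initial distribution mu, i.e. the integral of P_x against mu. *)
Definition null_sets (mu : probability (euclid R d) R) : set (set Omega) :=
  [set A | exists N, [/\ natural `[0, +oo[ N, A `<=` N &
                         (\int[mu]_x P x N = 0)%E]].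

(* F_t is the intersection, over s > t and over all initial distributions mu,
   of sigma(X_u : 0 <= u <= s) augmented by the P_mu-null sets. *)
Definition usual_filtration (t : R) : set (set Omega) :=
  \bigcap_(s in `]t, +oo[)
    \bigcap_(mu in [set: probability (euclid R d) R])
      <<s natural `[0, s] `|` null_sets mu >>.

Definition stopping_time (tau : Omega -> \bar R) : Prop :=
  (forall w, 0 <= tau w)%E /\
  (forall t, 0 <= t -> usual_filtration t [set w | (tau w <= t%:E)%E]).

Definition stopped_events (tau : Omega -> \bar R) : set (set Omega) :=
  [set A | measurable A /\
    forall t, 0 <= t -> usual_filtration t (A `&` [set w | (tau w <= t%:E)%E])].

Definition hitting_time (S : set (euclid R d)) (w : Omega) : \bar R :=
  ereal_inf [set t%:E | t in [set t | 0 <= t /\ S (X t w)]].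

Definition strong_markov : Prop :=
  forall tau, stopping_time tau ->
  forall A, stopped_events tau A ->
  forall s, 0 <= s -> forall B : set (euclid R d), measurable B ->
  forall x,
    P x (A `&` [set w | (tau w < +oo)%E]
           `&` [set w | B (X (fine (tau w) + s) w)]) =
    (\int[P x]_(w in A `&` [set w | tau w < +oo])
       P (X (fine (tau w)) w) (X s @^-1` B))%E.

(* The semigroup maps bounded continuous functions to continuous functions.
   For a nonterminating process this is implied by the variant of the Feller
   property which uses functions vanishing at infinity. *)
Definition feller : Prop :=
  forall t, 0 <= t -> forall phi : euclid R d -> R,
    continuous phi -> (exists M, forall x, `|phi x| <= M) ->
    continuous (fun x => fine (\int[P x]_w (phi (X t w))%:E)).

Record diffusion : Prop := Diffusion {
  diffusion_kernel : forall A, natural `[0, +oo[ A ->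
    measurable_fun [set: euclid R d] (P ^~ A);
  diffusion_start : forall x, P x [set w | X 0 w = x] = 1%E;
  diffusion_path : forall w, {within `[0, +oo[, continuous (X ^~ w)};
  (* the measures P_x are defined on all the events of the completed
     filtration *)
  diffusion_complete : forall t, 0 <= t ->
    usual_filtration t `<=` measurable;
  (* a property of the completed right-continuous filtration, by the debut
     theorem; the setting of the paper states it along with the filtration *)
  diffusion_hitting : forall S : set (euclid R d), measurable S ->
    stopping_time (hitting_time S);
  diffusion_strong_markov : strong_markov;
  diffusion_feller : feller
}.

Section Stopping.
Variable r : R.

(* Only meant for Borel H *)
Definition green (x : euclid R d) (H : set (euclid R d)) : \bar R :=
  (\int[lebesgue_measure]_(t in `[0%R, +oo[)
     ((expR (- (r * t)))%:E * P x (X t @^-1` H)))%E.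

Variable g : euclid R d -> R.

Definition discounted_reward (t : R) (w : Omega) : \bar R :=
  (expR (- (r * t)) * g (X t w))%:E.

(* The value at -oo is irrelevant, since stopping times are nonnegative. *)
Definition reward_at (tau : Omega -> \bar R) (w : Omega) : \bar R :=
  match tau w with
  | t%:E => discounted_reward t w
  | +oo%E => limf_esup (discounted_reward ^~ w) (pinfty_nbhs R)
  | -oo%E => 0%E
  end.

Definition expected_reward (tau : Omega -> \bar R) (x : euclid R d) : \bar R :=
  (\int[P x]_w reward_at tau w)%E.

Definition value_function (x : euclid R d) : \bar R :=
  ereal_sup [set expected_reward tau x | tau in stopping_time].

Definition optimal (tau : Omega -> \bar R) : Prop :=
  stopping_time tau /\ forall x, expected_reward tau x = value_function x.

End Stopping.

End Diffusion.

(* Main.v *)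
(* Write [potential phi x] for [E_x \int_0^oo e^{-rt} phi(X_t) dt], which is the
   integral of [phi] against the Green kernel at [x].  By the strong Markov property,
   [E_x (e^{-r tau} potential phi (X_tau); tau < oo)] is
   [E_x \int_tau^oo e^{-rt} phi(X_t) dt]; so it is at most [potential phi x] when
   [phi] is nonnegative, and equal to it when [tau] is the hitting time of a set
   outside which [phi] vanishes.
   Take [phi = f 1_S], whose potential is Vtilde.  Started inside [S], the process
   enters the complement of [S] through the boundary, where the potentials of the
   positive and negative parts of [f 1_{S^c}] agree; by the equality case for the
   complement they agree at the starting point too, so Vtilde = g on [S], hence
   Vtilde >= g everywhere.  The inequality then bounds all expected rewards by Vtilde,
   and the equality case for [S] shows that [h_S] attains this bound.
   The event [tau = oo] contributes nothing: a maximal inequality for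
   [e^{-rt} g(X_t)] along dyadic times shows that this process tends to 0. *)
Require Import Defs.
From HB Require Import structures.
From mathcomp Require Import all_boot all_order all_algebra.
From mathcomp Require Import all_classical all_reals all_analysis.
From mathcomp Require Import measurable_realfun.

Import Order.TTheory GRing.Theory Num.Theory.
Import numFieldNormedType.Exports.

Local Open Scope classical_set_scope.
Local Open Scope ring_scope.

Set Implicit Arguments.
Unset Strict Implicit.
Unset Printing Implicit Defensive.

(** * Integration *)

Section integral_set_function.
Import HBNNSimple.
Context d (T : measurableType d) (R : realType).

(** The integral is built from suprema over simple functions, which see a set function only on
    measurable sets. This serves [green], which is defined as a bare set function. *)
Lemma integral_eq_measure (m1 : set T -> \bar R) (m2 : {measure set T -> \bar R}) :
  (forall A, measurable A -> m1 A = m2 A) ->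
  forall D f, (\int[m1]_(x in D) f x = \int[m2]_(x in D) f x)%E.
Proof.
move=> m12 D f.
have e (k : {nnsfun T >-> R}) : sintegral m1 k = sintegral m2 k.
  by rewrite !sintegralET; apply: eq_fsbigr => x _; rewrite m12.
by rewrite /integral; congr (ereal_sup _ - ereal_sup _)%E; apply/seteqP;
  split=> _ [k kg <-]; exists k; rewrite ?e.
Qed.

End integral_set_function.

Section ge0_measurable_induction.
Import HBNNSimple.
Local Open Scope ereal_scope.
Context d (T : measurableType d) (R : realType) (Phi : (T -> \bar R) -> Prop).
Hypothesis Phi_indic : forall A, measurable A -> Phi (EFin \o \1_A).
Hypothesis Phi_scale : forall (k : R) (f : T -> \bar R), (0 <= k)%R ->
  measurable_fun setT f -> (forall x, 0 <= f x) -> Phi f ->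
  Phi (fun x => k%:E * f x).
Hypothesis Phi_add : forall f g : T -> \bar R,
  measurable_fun setT f -> (forall x, 0 <= f x) ->
  measurable_fun setT g -> (forall x, 0 <= g x) ->
  Phi f -> Phi g -> Phi (fun x => f x + g x).
Hypothesis Phi_lim : forall F : (T -> \bar R)^nat,
  (forall n, measurable_fun setT (F n)) -> (forall n x, 0 <= F n x) ->
  (forall x, {homo F^~ x : n m / (n <= m)%N >-> n <= m}) ->
  (forall n, Phi (F n)) -> Phi (fun x => limn (F ^~ x)).

(** The usual passage from indicators to simple functions to increasing limits, along
    [nnsfun_approx]. *)
Lemma ge0_measurable_ind (f : T -> \bar R) :
  measurable_fun setT f -> (forall x, 0 <= f x) -> Phi f.
Proof.
move=> mf f0; pose k_ := nnsfun_approx measurableT mf.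
have -> : f = (fun x => limn (fun n => (k_ n x)%:E)).
  apply/funext => x; apply/esym/cvg_lim => //.
  exact: cvg_nnsfun_approx.
apply: (@Phi_lim (fun n x => (k_ n x)%:E)).
- by move=> n; exact/measurable_EFinP.
- by move=> n x; rewrite lee_fin.
- by move=> x m n mn; rewrite lee_fin; exact/lefP/nd_nnsfun_approx.
move=> n; set k := k_ n.
have kE : (fun x => (k x)%:E) =
    (fun x => (\sum_(r <- finmap.enum_fset (fset_set (range k))) r * \1_(k @^-1` [set r]) x)%R%:E).
  by apply/funext => x; rewrite fimfunE fsbig_finite.
rewrite [X in Phi X]kE.
have s0 : {in finmap.enum_fset (fset_set (range k)), forall r, 0 <= r}%R.
  by move=> r; rewrite in_fset_set// inE => -[x _ <-].
elim: (finmap.enum_fset _) s0 => [_|r s ih s0].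
  rewrite [X in Phi X](_ : _ = EFin \o \1_set0); first exact: Phi_indic.
  by apply/funext => x; rewrite big_nil /= indic0.
have r0 : (0 <= r)%R by apply: s0; rewrite mem_head.
have mi (r' : R) : measurable_fun setT (\1_(k @^-1` [set r']) : T -> R).
  exact: measurable_indic.
have s1 : {in s, forall r, 0 <= r}%R.
  by move=> r' r's; apply: s0; rewrite in_cons r's orbT.
rewrite [X in Phi X](_ : _ = (fun x => r%:E * (EFin \o \1_(k @^-1` [set r])) x +
   (\sum_(r <- s) r * \1_(k @^-1` [set r]) x)%R%:E)); last first.
  by apply/funext => x; rewrite big_cons.
apply: Phi_add.
- exact/measurable_funeM/measurable_EFinP.
- by move=> x; rewrite lee_fin mulr_ge0.
- apply/measurable_EFinP; apply: measurable_sum => r'.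
  exact: measurable_funM.
- move=> x; rewrite lee_fin big_seq; apply: sumr_ge0 => r' r's.
  by rewrite mulr_ge0// s1.
- apply: Phi_scale => //; first exact/measurable_EFinP.
  by move=> x /=; rewrite lee_fin.
  exact: Phi_indic.
- exact: ih.
Qed.

End ge0_measurable_induction.

Section lebesgue_shift.
Local Open Scope ereal_scope.
Context (R : realType).
Local Notation mu := (@lebesgue_measure R).

Lemma ge0_integral_shift (a : R) (f : R -> \bar R) :
  measurable_fun setT f -> (forall t, 0 <= f t) ->
  \int[mu]_(t in `[0%R, +oo[) f (a + t)%R = \int[mu]_(t in `[a, +oo[) f t.
Proof.
move=> mf f0.
pose phi : measurableTypeR R -> measurableTypeR R := fun t => (a + t)%R.
have mphi : measurable_fun setT phi by exact: measurable_funD.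
have pre (i : interval R) :
    phi @^-1` [set` i] = [set t | (a + t)%R \in i] by [].
have preE : `[0%R, +oo[%classic = phi @^-1` `[a, +oo[.
  by rewrite pre; apply/seteqP; split => t /=; rewrite !in_itv/= !andbT lerDl.
rewrite preE -(@ge0_integral_pushforward _ _ _ _ R phi mphi mu `[a, +oo[%classic f)//;
  last exact: measurable_funS mf.
(* The image of Lebesgue measure under a translation gives half-open intervals their length, so
   uniqueness identifies it with [mu]. *)
apply: eq_measure_integral => A mA _.
  apply/esym/lebesgue_measure_unique => // _ [[b c] _ <-].
  rewrite -[RHS]/(mu (phi @^-1` `]b, c]%classic)) pre.
  have -> : [set t | (a + t)%R \in `]b, c]] = `](b - a)%R, (c - a)%R]%classic.
    by apply/seteqP; split => t /=; rewrite !in_itv/= ltrBlDl lerBrDl.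
  by rewrite !lebesgue_measure_itv/= !lte_fin ltrD2r -!EFinB opprB addrA subrK.

Qed.

End lebesgue_shift.

(** * Measurability of continuous paths *)

Section path_measurability.
Context (R : realType) (n : nat).
Local Notation E := (euclid R n).

Lemma open_measurable_euclid (U : set E) : open U -> measurable U.
Proof. by move=> oU; exact: sub_sigma_algebra. Qed.

Lemma closed_measurable_euclid (U : set E) : closed U -> measurable U.
Proof.
move=> cU; rewrite -[U]setCK; apply: measurableC; apply: open_measurable_euclid.
exact: closed_openC.
Qed.

Lemma continuous_measurable_euclid (g : E -> R) :
  continuous g -> measurable_fun setT g.
Proof.
move=> cg; apply: (measurability _ (RGenOInfty.measurableE R)) => //.
move=> _ [_ [x ->] <-]; rewrite setTI; apply: open_measurable_euclid.
by apply: open_comp => // y _; exact: cg.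
Qed.

Lemma measurable_fun_cvg_euclid d (T : measurableType d) (D : set T)
    (h : (T -> E)^nat) (f : T -> E) :
  (forall m, measurable_fun D (h m)) ->
  (forall x, D x -> h ^~ x @ \oo --> f x) -> measurable_fun D f.
Proof.
move=> mh hf mD; move: (mD); apply: (measurability (@open E)) => // _ [U oU <-].
(* [V k] is closed and shrinks [U] by [1/(k+1)]. For [x] in [D], [f x] lies in [U] exactly when
   [h m x] is eventually in some fixed [V k]. *)
pose V k := [set y : E | ball y k.+1%:R^-1 `<=` U].
have mV k : measurable (V k).
  apply: closed_measurable_euclid.
  rewrite -[V k]setCK; apply: open_closedC; rewrite openE => y.
  move/existsNP => [z /not_implyP[yz nUz]].
  have [e /= e0 He] : \forall y' \near y, ball y' k.+1%:R^-1 z.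
    have k0 : 0 < k.+1%:R^-1 :> R by rewrite invr_gt0.
    have : nbhs y (ball z k.+1%:R^-1).
      by apply: open_nbhs_nbhs; split; [exact: ball_open|exact: ball_sym].
    by apply: filterS => y' /ball_sym.
  exists e => //= y' yy' Vy'; apply: nUz.
  by apply: Vy'; exact: He.
have -> : D `&` f @^-1` U =
    \bigcup_k \bigcup_N \bigcap_(m in [set m | (N <= m)%N]) (D `&` h m @^-1` V k).
  apply/seteqP; split=> [x [Dx Ux]|x [k _ [N _ HN]]].
    have /nbhs_ballP[e /= e0 eU] : nbhs (f x) U by exact: open_nbhs_nbhs.
    (* One share of [e] covers the distance from [f x] to [h m x], the other the radius in [V k]. *)
    have [k ke] : exists k, (k.+1%:R^-1 + k.+1%:R^-1 : R) <= e.
      have [k _ /(_ _ (leqnn k)) /=] := near_infty_natSinv_lt (PosNum (divr_gt0 e0 (ltr0n _ 2))).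
      by move=> kk; exists k; rewrite (splitr e) lerD// ltW.
    exists k => //.
    have /cvg_ballP/(_ (k.+1%:R^-1)) := hf x Dx.
    case; first by rewrite invr_gt0.
    move=> N _ HN; exists N => // m /= Nm; split => //= z hz.
    apply: eU; apply: (le_ball ke); exact: ball_triangle (HN _ Nm) hz.
  have [Dx _] := HN N (leqnn N).
  split=> //=.
  have /cvg_ballP/(_ (k.+1%:R^-1)) := hf x Dx.
  case; first by rewrite invr_gt0.
  move=> M _ HM; have [] := HN (maxn N M) (leq_maxl _ _).
  move=> _; apply; apply: ball_sym; apply: HM.
  by rewrite /= leq_maxr.
apply: bigcup_measurable => k _; apply: bigcup_measurable => N _.
apply: bigcap_measurable; first by exists N => /=.
by move=> m _; exact: mh.
Qed.

Lemma within_itv_cvg (T : topologicalType) (a : R) (y : R -> T) (t : R) :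
  {within `[a, +oo[, continuous y} -> a <= t ->
  y s @[s --> within `[a, +oo[ (nbhs t)] --> y t.
Proof. by move=> /subspace_continuousP cy at_; apply: cy; rewrite /= in_itv/= andbT. Qed.

Lemma within_nbhsP (T : topologicalType) (a : R) (y : R -> T) :
  {within `[a, +oo[, continuous y} ->
  forall t, a <= t -> forall U, nbhs (y t) U ->
  exists2 e : R, 0 < e & forall s, a <= s -> `|t - s| < e -> U (y s).
Proof.
move=> cy t at_ U yU; have /(_ _ yU) := within_itv_cvg cy at_.
rewrite /= nbhs_filterE; case/nbhs_ballP => e /= e0 He; exists e => // s as_ ts.
by apply: He => //=; rewrite in_itv/= andbT.
Qed.

(* Time is clipped at 0 because paths are only controlled on [0, +oo[. *)
Lemma measurable_fun_path d (T : measurableType d) (Y : R -> T -> E) :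
  (forall t, 0 <= t -> measurable_fun setT (Y t)) ->
  (forall w, {within `[0, +oo[, continuous (Y ^~ w)}) ->
  measurable_fun [set: R * T] (fun p => Y (Num.max 0 p.1) p.2).
Proof.
move=> mY cY.
(* [s k t / (k+1)] is the last grid point of mesh [1/(k+1)] not after [max 0 t]. Freezing time there
   leaves countably many measurable slices, and path continuity gives the limit. *)
pose s k (t : R) : nat := Num.truncn (k.+1%:R * Num.max 0 t).
apply: (@measurable_fun_cvg_euclid _ _ setT
  (fun k p => Y ((s k p.1)%:R / k.+1%:R) p.2)).
  move=> k _ B mB; rewrite setTI.
  pose D i := [set t : R | s k t = i].
  rewrite (_ : _ @^-1` _ =
    \bigcup_i (D i `*` (Y (i%:R / k.+1%:R) @^-1` B))); last first.
    apply/seteqP; split=> [[t w]/= Bw|[t w] [i _ [/= <-]]//].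
    by exists (s k t).
  apply: bigcup_measurable => i _; apply: measurableX; last first.
    by rewrite -[X in measurable X]setTI; apply: mY => //; rewrite divr_ge0.
  have mge j : measurable [set t | (j <= s k t)%N].
    rewrite (_ : [set t | _] = setT `&` [set t | (j%:R <= k.+1%:R * Num.max 0 t :> R)%R]).
      apply: measurable_fun_le => //.
      by apply: measurable_funM => //; exact: measurable_maxr.
    rewrite setTI; apply/seteqP; split => t /=;
      by rewrite truncn_ge_nat// mulr_ge0// le_max lexx.
  rewrite (_ : D i = [set t | (i <= s k t)%N] `\` [set t | (i.+1 <= s k t)%N]).
    exact: measurableD.
  apply/seteqP; split => t; first by move=> /= ->; rewrite leqnn ltnn.
  by move=> [/= h1 /negP]; rewrite -leqNgt => h2; apply/eqP; rewrite eqn_leq h2.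
move=> [t w] _ /=.
set m := Num.max 0 t.
have m0 : 0 <= m by rewrite le_max lexx.
have sm : (fun k => (s k t)%:R / k.+1%:R : R) @ \oo --> m.
  apply/cvgrPdist_le => e e0; near=> k.
  have h1 : (s k t)%:R <= k.+1%:R * m by rewrite truncn_le// mulr_ge0.
  have h2 : k.+1%:R * m < (s k t).+1%:R by exact: truncnS_gt.
  rewrite ger0_norm; last by rewrite subr_ge0 ler_pdivrMr// mulrC.
  apply: (@le_trans _ _ k.+1%:R^-1).
    by rewrite lerBlDr -[X in X + _]mul1r -mulrDl nat1r ler_pdivlMr// mulrC ltW.
  apply/ltW; near: k; exact: near_infty_natSinv_lt (PosNum e0).
move=> U /(within_nbhsP (cY w) m0)[e e0 He].
move/cvgrPdist_lt/(_ _ e0): sm; apply: filterS => k.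
by apply: He; rewrite divr_ge0.
Unshelve. all: by end_near. Qed.

End path_measurability.
(** * Filtrations and stopping times *)

Section diffusion_basics.
Context (R : realType) (n : nat) (dO : measure_display) (Omega : measurableType dO).
Context (X : R -> Omega -> euclid R n) (P : euclid R n -> probability Omega R).
Hypothesis DX : diffusion X P.
Local Notation E := (euclid R n).

Let path_events := \bigcup_(s in `[0, +oo[) preimage_set_system setT (X s) measurable.

(* The events of [diffusion_kernel] are those of this sigma-algebra, so measurability in
   the starting point is only available for functions measurable on this space. *)
Definition natural_space := g_sigma_algebraType path_events.

Lemma natural_mono (T T' : set R) : T `<=` T' -> natural X T `<=` natural X T'.
Proof.
move=> TT'; apply: smallest_sub; first exact: smallest_sigma_algebra.
by move=> A [s Ts HA]; apply: sub_sigma_algebra; exists s => //; exact: TT'.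
Qed.

Lemma natural_usual (t : R) : natural X `[0, t] `<=` usual_filtration X P t.
Proof.
move=> A nA s /=; rewrite in_itv/= andbT => ts mu _; apply: sub_sigma_algebra; left.
apply: natural_mono nA => u /=; rewrite !in_itv/= => /andP[-> ut].
exact: le_trans (ltW ts).
Qed.

Lemma natural_cylinder (t u : R) (B : set E) : 0 <= u <= t -> measurable B ->
  natural X `[0, t] (X u @^-1` B).
Proof.
move=> ut mB; apply: sub_sigma_algebra; exists u; first by rewrite /= in_itv.
by exists B => //; rewrite setTI.
Qed.

(** Natural events lie in the usual filtration, whose events are measurable by
    [diffusion_complete]. *)
Lemma measurable_X (t : R) : 0 <= t -> measurable_fun setT (X t).
Proof.
move=> t0 _ B mB; rewrite setTI; apply: (diffusion_complete DX t0).
by apply: natural_usual; apply: natural_cylinder; rewrite ?t0 ?lexx.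
Qed.

Lemma natural_measurable : natural X `[0, +oo[ `<=` measurable.
Proof.
apply: smallest_sub; first exact: sigma_algebra_measurable.
move=> A [s /=]; rewrite in_itv/= andbT => s0 [B mB <-].
exact: measurable_X.
Qed.

Lemma measurable_natural_id :
  measurable_fun setT (id : Omega -> natural_space).
Proof. by move=> _ A mA; rewrite setTI; exact: natural_measurable. Qed.

Lemma measurable_X_natural (t : R) : 0 <= t ->
  measurable_fun setT (X t : natural_space -> E).
Proof.
move=> t0 _ B mB; apply: sub_sigma_algebra; exists t; last by exists B.
by rewrite /= in_itv/= t0.
Qed.

Lemma measurable_path :
  measurable_fun [set: R * Omega] (fun p => X (Num.max 0 p.1) p.2).
Proof. exact: (measurable_fun_path measurable_X (diffusion_path DX)). Qed.

Lemma measurable_path_natural :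
  measurable_fun [set: R * natural_space] (fun p => X (Num.max 0 p.1) p.2).
Proof. exact: (measurable_fun_path measurable_X_natural (diffusion_path DX)). Qed.

Lemma usual_filtrationT (t : R) : usual_filtration X P t setT.
Proof. by move=> s _ mu _; exact: (@measurableT _ (g_sigma_algebraType _)). Qed.

Lemma usual_filtration0 (t : R) : usual_filtration X P t set0.
Proof. by move=> s _ mu _; exact: (@measurable0 _ (g_sigma_algebraType _)). Qed.

Lemma usual_filtration_mono (s t : R) : s <= t ->
  usual_filtration X P s `<=` usual_filtration X P t.
Proof.
move=> st A FA u /=; rewrite in_itv/= andbT => tu mu mumu.
by apply: FA => //=; rewrite in_itv/= andbT (le_lt_trans st).
Qed.

Lemma measurable_stopping_time (tau : Omega -> \bar R) :
  stopping_time X P tau -> measurable_fun setT tau.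
Proof.
move=> [tau0 Ftau]; apply: (measurability _ (ErealGenOInfty.measurableE R)) => //.
move=> _ [_ [x ->] <-]; rewrite setTI.
rewrite (_ : _ @^-1` _ = ~` [set w | (tau w <= x%:E)%E]); last first.
  apply/seteqP; split => w /=; rewrite in_itv/= andbT.
    by move=> h; apply/negP; rewrite -ltNge.
  by move=> /negP; rewrite -ltNge.
apply: measurableC; have [x0|x0] := leP 0 x.
  exact: (diffusion_complete DX x0 (Ftau _ x0)).
rewrite (_ : [set w | _] = set0)//; apply/seteqP; split => // w /= wx.
by have := le_trans (tau0 w) wx; rewrite lee_fin leNgt x0.
Qed.

Lemma measurable_stopping_lty (tau : Omega -> \bar R) :
  stopping_time X P tau -> measurable [set w | (tau w < +oo)%E].
Proof.
move=> /measurable_stopping_time mtau; rewrite -[X in measurable X]setTI.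
by apply: measurable_lte => //; exact: measurable_cst.
Qed.

Lemma fine_stopping_ge0 (tau : Omega -> \bar R) w :
  stopping_time X P tau -> 0 <= fine (tau w).
Proof. by move=> [tau0 _]; exact: fine_ge0. Qed.

(* On [tau = +oo] this is [X 0], as [fine +oo = 0]. *)
Lemma measurable_X_stopped (tau : Omega -> \bar R) (s : R) :
  stopping_time X P tau -> 0 <= s ->
  measurable_fun setT (fun w => X (fine (tau w) + s) w).
Proof.
move=> st s0.
rewrite (_ : (fun w => _) = (fun p => X (Num.max 0 p.1) p.2) \o
  (fun w => (fine (tau w) + s, w))); last first.
  apply/funext => w /=; congr (X _ w); apply/esym/max_idPr.
  by rewrite addr_ge0// fine_stopping_ge0.
apply: measurableT_comp; first exact: measurable_path.
apply: measurable_fun_pair => //; apply: measurable_funD => //.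
apply: measurableT_comp; first exact: fine_measurable.
exact: measurable_stopping_time.
Qed.

Lemma stopping_time_cst (t : R) : 0 <= t -> stopping_time X P (cst t%:E).
Proof.
move=> t0; split => [w|s s0]; first by rewrite lee_fin.
have [ts|ts] := leP t s.
  rewrite (_ : [set w | _] = setT); first exact: usual_filtrationT.
  by apply/seteqP; split => // w _ /=; rewrite lee_fin.
rewrite (_ : [set w | _] = set0); first exact: usual_filtration0.
by apply/seteqP; split => // w /=; rewrite lee_fin leNgt ts.
Qed.

Lemma stopped_events_cst (t : R) (A : set Omega) : 0 <= t ->
  usual_filtration X P t A -> stopped_events X P (cst t%:E) A.
Proof.
move=> t0 FA; split; first exact: diffusion_complete FA.
move=> s s0; have [ts|ts] := leP t s.
  rewrite (_ : _ `&` _ = A); first exact: usual_filtration_mono FA.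
  by apply/seteqP; split => w /=; [case|rewrite lee_fin ts].
rewrite (_ : _ `&` _ = set0); first exact: usual_filtration0.
by apply/seteqP; split => // w /= [_]; rewrite lee_fin leNgt ts.
Qed.

(** The overlap of [tau <= c] and [tau <= t] is [tau <= min c t]. These events arise when
    [exp (- r tau)] is decomposed by [layer_cake]. *)
Lemma stopped_events_le (tau : Omega -> \bar R) (A : set Omega) (c : R) :
  stopping_time X P tau -> stopped_events X P tau A -> 0 <= c ->
  stopped_events X P tau (A `&` [set w | (tau w <= c%:E)%E]).
Proof.
move=> [tau0 Ftau] [mA FA] c0; split.
  by apply: measurableI => //; exact: (diffusion_complete DX c0 (Ftau _ c0)).
move=> t t0; have m0 : 0 <= Num.min c t by rewrite le_min c0.
rewrite -setIA (_ : _ `&` [set w | (tau w <= t%:E)%E] =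
  [set w | (tau w <= (Num.min c t)%:E)%E]).
  apply: (@usual_filtration_mono (Num.min c t)); first by rewrite ge_min lexx orbT.
  exact: FA.
apply/seteqP; split => w /=; rewrite EFin_min le_min; first by case=> -> ->.
by move=> /andP[].
Qed.

End diffusion_basics.
(** * Weighted and iterated integrals *)

Section tonelli_domain.
Local Open Scope ereal_scope.
Context d1 d2 (T1 : measurableType d1) (T2 : measurableType d2) (R : realType).
Variables (m1 : {sigma_finite_measure set T1 -> \bar R}).
Variables (m2 : {sigma_finite_measure set T2 -> \bar R}).

Lemma ge0_integral_swap (A : set T1) (B : set T2) (f : T1 * T2 -> \bar R) :
  measurable A -> measurable B -> measurable_fun setT f -> (forall z, 0 <= f z) ->
  \int[m1]_(x in A) \int[m2]_(y in B) f (x, y) =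
  \int[m2]_(y in B) \int[m1]_(x in A) f (x, y).
Proof.
move=> mA mB mf f0; pose h := f \_ (A `*` B).
have mh : measurable_fun setT h.
  by apply/(measurable_restrictT _ (measurableX mA mB)); exact: measurable_funS mf.
have h0 z : 0 <= h z by exact: erestrict_ge0.
have hE x y : h (x, y) = if (x \in A) && (y \in B) then f (x, y) else 0.
  by rewrite /h patchE in_setX.
transitivity (\int[m1]_x \int[m2]_y h (x, y)).
  rewrite integral_mkcond; apply: eq_integral => x _; rewrite patchE.
  case: ifPn => xA; last first.
    by rewrite integral0_eq// => y _; rewrite hE (negbTE xA).
  by rewrite integral_mkcond; apply: eq_integral => y _; rewrite patchE hE xA.
rewrite (fubini_tonelli h mh h0) [RHS]integral_mkcond.
apply: eq_integral => y _; rewrite patchE.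
case: ifPn => yB; last first.
  by rewrite integral0_eq// => x _; rewrite hE (negbTE yB) andbF.
by rewrite [RHS]integral_mkcond; apply: eq_integral => x _; rewrite patchE hE yB andbT.
Qed.

End tonelli_domain.

Section density.
Local Open Scope ereal_scope.
Context d1 d2 (T1 : measurableType d1) (T2 : measurableType d2) (R : realType).
Variables (m : {measure set T1 -> \bar R}) (nu : set T2 -> \bar R).
Variables (Y : T1 -> T2) (k : T1 -> R).
Hypotheses (mY : measurable_fun setT Y) (mk : measurable_fun setT k).
Hypothesis k0 : forall z, (0 <= k z)%R.
Hypothesis nuE : forall H, measurable H -> nu H = \int[m]_(z in Y @^-1` H) (k z)%:E.

(** The formula taken on all sets, so that it can be declared a measure; [nu] is known to agree with
    it on measurable sets. *)
Let nu' (H : set T2) := \int[m]_(z in Y @^-1` H) (k z)%:E.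

Let nu'0 : nu' set0 = 0.
Proof. by rewrite /nu' preimage_set0 integral_set0. Qed.

Let nu'_ge0 H : 0 <= nu' H.
Proof. by apply: integral_ge0 => z _; rewrite lee_fin. Qed.

Let nu'_sigma_additive : semi_sigma_additive nu'.
Proof.
move=> F mF tF mUF; rewrite /nu' preimage_bigcup.
have mpre H : measurable H -> measurable (Y @^-1` H).
  by move=> mH; rewrite -[X in measurable X]setTI; exact: mY.
have mkE : measurable_fun setT (EFin \o k) by exact/measurable_EFinP.
have k0E z : 0 <= (EFin \o k) z by rewrite lee_fin.
apply: (semi_sigma_additive_nng_induced (mu := m) mkE k0E).
- by move=> i; exact: mpre.
- apply/trivIsetP => i j _ _ ij; rewrite -preimage_setI.
  by move/trivIsetP : tF => /(_ _ _ Logic.I Logic.I ij) ->; rewrite preimage_set0.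
- by apply: bigcup_measurable => i _; exact: mpre.
Qed.

HB.instance Definition _ := isMeasure.Build _ _ _ nu' nu'0 nu'_ge0 nu'_sigma_additive.

Lemma density_measure : exists nu1 : {measure set T2 -> \bar R},
  forall H, measurable H -> nu H = nu1 H.
Proof. by exists nu'. Qed.

Lemma ge0_integral_density (phi : T2 -> \bar R) :
  measurable_fun setT phi -> (forall y, 0 <= phi y) ->
  \int[nu]_y phi y = \int[m]_z ((k z)%:E * phi (Y z)).
Proof.
move=> mphi phi0; rewrite (@integral_eq_measure _ _ _ nu nu')//.
apply: (@ge0_measurable_ind _ _ _ (fun phi => \int[nu']_y phi y =
    \int[m]_z ((k z)%:E * phi (Y z)))) => //.
- move=> A mA; rewrite integral_indic// setIT [LHS]integral_mkcond.
  apply: eq_integral => z _; rewrite patchE /= indicE.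
  have -> : (z \in Y @^-1` A) = (Y z \in A) by apply/idP/idP; rewrite !inE.
  by case: ifP => _; rewrite ?mule1 ?mule0.
- move=> c f c0 mf f0 h; rewrite ge0_integralZl_EFin// h -ge0_integralZl_EFin//.
  + by apply: eq_integral => z _; rewrite muleCA.
  + by move=> z _; rewrite mule_ge0// lee_fin.
  + by apply: emeasurable_funM; [exact/measurable_EFinP|exact: measurableT_comp].
- move=> f g mf f0 mg g0 hf hg; rewrite ge0_integralD// hf hg -ge0_integralD//.
  + by apply: eq_integral => z _; rewrite ge0_muleDr.
  + by move=> z _; rewrite mule_ge0// lee_fin.
  + by apply: emeasurable_funM; [exact/measurable_EFinP|exact: measurableT_comp].
  + by move=> z _; rewrite mule_ge0// lee_fin.
  + by apply: emeasurable_funM; [exact/measurable_EFinP|exact: measurableT_comp].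
- move=> F mF F0 ndF hF; rewrite monotone_convergence//.
  under eq_fun do rewrite hF.
  rewrite -monotone_convergence//.
  + apply: eq_integral => z _; rewrite limeMl//.
    by apply: ereal_nondecreasing_is_cvgn => i j; exact: ndF.
  + by move=> i; apply: emeasurable_funM => //; exact: measurableT_comp.
  + by move=> i z _; rewrite mule_ge0// lee_fin.
  + by move=> z _ i j ij; rewrite lee_wpmul2l// ?lee_fin// ndF.
Qed.

End density.
Section exponential_weight.
Local Open Scope ereal_scope.
Context (R : realType) (r : R).
Local Notation mu := (@lebesgue_measure R).

Lemma measurable_expRN : measurable_fun setT (fun t => expR (- (r * t))).
Proof.
apply: measurableT_comp; first exact: measurable_expR.
by apply: measurableT_comp => //; exact: measurable_funM.
Qed.

Hypothesis r_gt0 : (0 < r)%R.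

(** The antiderivative is [- exp (- r c)]. A discount factor thus becomes the mass of [[a, +oo[]
    under the exponential law. *)
Lemma integral_expR_tail (a : R) :
  \int[mu]_(c in `[a, +oo[) (r * expR (- (r * c)))%:E = (expR (- (r * a)))%:E.
Proof.
have cexp : continuous (fun c : R => expR (- r * c))%R.
  by move=> c; apply: continuous_comp; [exact: mulrl_continuous|exact: continuous_expR].
under eq_integral do rewrite -mulNr.
rewrite (@ge0_continuous_FTC2y _ _ (fun c => - (expR (- r * c)))%R _ 0%R).
- by rewrite sub0e EFinN oppeK mulNr.
- by move=> c _; rewrite mulr_ge0 ?expR_ge0// ltW.
- apply: continuous_subspaceT => c.
  apply: (@continuous_comp _ _ _ (fun c => expR (- r * c))%R ( *%R r)%R c); first exact: cexp.
  exact: mulrl_continuous.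
- rewrite -oppr0; apply: cvgN.
  rewrite (_ : (fun c => expR (- r * c))%R = (fun z => expR (- z))%R \o (fun z => r * z)%R).
    apply: (@cvg_comp _ _ _ _ _ _ (pinfty_nbhs R)); last exact: cvgr_expR.
    exact: gt0_cvgMry.
  by apply: eq_fun => c; rewrite mulNr.
- by move=> c _; apply: ex_derive.
- by apply: cvgN; apply/cvg_at_right_filter; exact: cexp.
- move=> c _; rewrite derive1_comp// derive1N// derive1_id mulN1r derive1_comp// derive1E.
  have /funeqP -> := @derive_expR R.
  by rewrite derive1Ml// derive1_id mulr1 mulrN opprK mulrC.
Qed.

(** With [exp (- r a)] written as the integral of [r exp (- r c)] over [c >= a], Tonelli turns a
    random weight into a mixture of restrictions to the events [a <= c]. *)
Lemma layer_cake d (T : measurableType d) (m : {sigma_finite_measure set T -> \bar R})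
    (a : T -> R) (A : set T) (Y : T -> \bar R) :
  measurable A -> measurable_fun setT a -> (forall w, (0 <= a w)%R) ->
  measurable_fun setT Y -> (forall w, 0 <= Y w) ->
  \int[m]_(w in A) ((expR (- (r * a w)))%:E * Y w) =
  \int[mu]_(c in `[0%R, +oo[) ((r * expR (- (r * c)))%:E *
    \int[m]_(w in A `&` [set w | (a w <= c)%R]) Y w).
Proof.
move=> mA ma a0 mY Y0.
pose D : set (T * R) := [set p | (a p.1 <= p.2)%R].
have mD : measurable D.
  rewrite -[D]setTI; apply: measurable_fun_le => //.
  exact: measurableT_comp.
pose k (c : R) : R := (r * expR (- (r * c)))%R.
have k0 c : (0 <= k c)%R by rewrite mulr_ge0 ?expR_ge0// ltW.
have mk : measurable_fun setT k.
  by apply: measurable_funM => //; exact: measurable_expRN.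
pose f (p : T * R) := (\1_D p * k p.2)%:E * Y p.1.
have mf : measurable_fun setT f.
  apply: emeasurable_funM; last exact: measurableT_comp.
  apply/measurable_EFinP; apply: measurable_funM; first exact: measurable_indic.
  exact: measurableT_comp.
have f0 p : 0 <= f p by rewrite mule_ge0// lee_fin mulr_ge0.
transitivity (\int[m]_(w in A) \int[mu]_(c in `[0%R, +oo[) f (w, c)).
  apply: eq_integral => w _; rewrite -integral_expR_tail /f /=.
  rewrite ge0_integralZr//; first last.
  - by move=> c _; rewrite lee_fin mulr_ge0.
  - apply/measurable_EFinP/measurable_funTS; apply: measurable_funM => //.
    rewrite (_ : (fun c => _) = \1_D \o (fun c => (w, c))) //.
    apply: measurableT_comp; first exact: measurable_indic.
    exact: measurable_pair1.
  congr (_ * _).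
  rewrite [LHS]integral_mkcond [RHS]integral_mkcond; apply: eq_integral => c _.
  have wcD : ((w, c) \in D) = (a w <= c)%R by apply/idP/idP; rewrite inE.
  rewrite !patchE indicE wcD !mem_setE !in_itv/= !andbT.
  have [awc|awc] := leP (a w) c; last by case: ifP; rewrite // mul0r.
  by rewrite (le_trans (a0 w) awc) mul1r.
rewrite (ge0_integral_swap m mu mA _ mf f0)//.
apply: eq_integral => c _.
rewrite integral_mkcondr -ge0_integralZl_EFin//; first last.
- exact: k0.
- apply: measurable_funTS; apply/(measurable_restrictT _ _).1 => //.
    by rewrite -[X in measurable X]setTI; exact: measurable_fun_le.
  exact: measurable_funTS.
- by move=> w _; apply: erestrict_ge0.
apply: eq_integral => w _; rewrite /f /= indicE patchE.
have -> : ((w, c) \in D) = (w \in [set w | (a w <= c)%R]).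
  by apply/idP/idP; rewrite !inE.
by case: ifP => _; rewrite ?mul1r// mul0r mul0e mule0.
Qed.

End exponential_weight.
(** * Potentials and the strong Markov property *)

Section potential_theory.
Local Open Scope ereal_scope.
Context (R : realType) (n : nat) (dO : measure_display) (Omega : measurableType dO).
Context (X : R -> Omega -> euclid R n) (P : euclid R n -> probability Omega R).
Hypothesis DX : diffusion X P.
Context (r : R).
Local Notation E := (euclid R n).
Local Notation mu := (@lebesgue_measure R).

Definition tail (phi : E -> \bar R) (a : R) (w : Omega) : \bar R :=
  \int[mu]_(t in `[a, +oo[) ((expR (- (r * t)))%:E * phi (X t w)).

Definition potential (phi : E -> \bar R) (y : E) : \bar R :=
  \int[P y]_w tail phi 0%R w.

Section measurability.
Context dT (T : measurableType dT) (Y : R -> T -> E).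
Hypothesis mY : measurable_fun setT (fun p : R * T => Y (Num.max 0 p.1)%R p.2).
Variables (phi : E -> \bar R).
Hypotheses (mphi : measurable_fun setT phi) (phi0 : forall y, 0 <= phi y).

Lemma measurable_fun_discounted_path :
  measurable_fun setT (fun p : T * R => (expR (- (r * p.2)))%:E *
    phi (Y (Num.max 0 p.2)%R p.1)).
Proof.
apply: emeasurable_funM.
  apply/measurable_EFinP.
  exact: (measurableT_comp (measurable_expRN r) measurable_snd).
apply: (measurableT_comp mphi).
by apply: (measurableT_comp (g := fun p : T * R => (p.2, p.1)) mY); exact: measurable_fun_pair.
Qed.

(** The moving lower limit becomes the indicator of [D], and Tonelli applies. The space [T] is
    abstract because both [Omega] and [natural_space X] occur. *)
Lemma measurable_fun_tail (a : T -> R) :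
  measurable_fun setT a -> (forall w, (0 <= a w)%R) ->
  measurable_fun setT (fun w => \int[mu]_(t in `[a w, +oo[)
    ((expR (- (r * t)))%:E * phi (Y t w))).
Proof.
move=> ma a0; pose D : set (T * R) := [set p | (a p.1 <= p.2)%R].
have mD : measurable D.
  rewrite -[D]setTI; apply: measurable_fun_le => //.
  exact: measurableT_comp.
pose f (p : T * R) : \bar R := (\1_D p)%:E * ((expR (- (r * p.2)))%:E *
    phi (Y (Num.max 0 p.2)%R p.1)).
have mf : measurable_fun setT f.
  apply: emeasurable_funM; last exact: measurable_fun_discounted_path.
  by apply/measurable_EFinP; exact: measurable_indic.
have f0 p : 0 <= f p by rewrite !mule_ge0// lee_fin// expR_ge0.
rewrite (_ : (fun w => _) = (fun w => \int[mu]_t f (w, t))).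
  exact: measurable_fun_fubini_tonelli_F.
apply/funext => w; rewrite [LHS]integral_mkcond; apply: eq_integral => t _.
have wtD : ((w, t) \in D) = (a w <= t)%R by apply/idP/idP; rewrite inE.
rewrite /f patchE indicE wtD mem_setE in_itv/= andbT.
have [awt|awt] := leP (a w) t; last by rewrite mul0e.
by rewrite mul1e max_r// (le_trans (a0 w)).
Qed.

End measurability.

Lemma tail_ge0 phi a w : (forall y, 0 <= phi y) -> 0 <= tail phi a w.
Proof. by move=> phi0; apply: integral_ge0 => t _; rewrite mule_ge0// lee_fin expR_ge0. Qed.

Lemma potential_ge0 phi y : (forall y, 0 <= phi y) -> 0 <= potential phi y.
Proof. by move=> phi0; apply: integral_ge0 => w _; exact: tail_ge0. Qed.

(** [diffusion_kernel] makes [P (h u)] a probability kernel on the natural events, which is why [k]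
    lives over [natural_space X]. *)
Lemma measurable_integral_P dU (U : measurableType dU) (h : U -> E)
    (k : U * natural_space X -> \bar R) :
  measurable_fun setT h -> measurable_fun setT k -> (forall z, 0 <= k z) ->
  measurable_fun setT (fun u => \int[P (h u)]_w k (u, w)).
Proof.
move=> mh mk k0.
(* Pushing forward along the identity restricts [P (h u)] to the natural events. *)
pose Qid (u : U) : {measure set (natural_space X) -> \bar R} :=
  pushforward (P (h u)) (id : Omega -> natural_space X).
pose Q := Qid (measurable_natural_id DX).
have mQ B : measurable B -> measurable_fun setT (Q ^~ B).
  by move=> mB; exact: (measurableT_comp (diffusion_kernel DX mB) mh).
have Q1 u : Q u setT = 1 by exact: probability_setT.
pose Qk := isKernel.Build _ _ _ _ _ Q mQ.
pose Qk' : R.-ker U ~> natural_space X := HB.pack Q Qk.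
pose Qp := Kernel_isProbability.Build _ _ _ _ _ Qk' Q1.
pose l : R.-fker U ~> natural_space X := HB.pack Q Qk Qp.
have := measurable_fun_integral_finite_kernel k l k0 mk.
apply: eq_measurable_fun => u _.
rewrite [LHS](@ge0_integral_pushforward _ _ _ _ _ _ (measurable_natural_id DX))//.
exact: (measurableT_comp mk (measurable_pair1 u)).
Qed.

Lemma measurable_integral_P_cst (k : natural_space X -> \bar R) :
  measurable_fun setT k -> (forall z, 0 <= k z) ->
  measurable_fun setT (fun y => \int[P y]_w k w).
Proof.
move=> mk k0; apply: (@measurable_integral_P _ E id (k \o snd)) => //.
  exact: measurableT_comp.
by move=> z; exact: k0.
Qed.

Section nonnegative.
Variables (phi : E -> \bar R).
Hypotheses (mphi : measurable_fun setT phi) (phi0 : forall y, 0 <= phi y).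

Lemma measurable_potential : measurable_fun setT (potential phi).
Proof.
apply: measurable_integral_P_cst; last by move=> w; exact: tail_ge0.
apply: (measurable_fun_tail (measurable_path_natural DX) mphi phi0) => //.
Qed.

Lemma tail_shift (a : R) w : (0 <= a)%R ->
  tail phi a w = (expR (- (r * a)))%:E *
    \int[mu]_(s in `[0%R, +oo[) ((expR (- (r * s)))%:E * phi (X (a + s)%R w)).
Proof.
move=> a0; pose f (t : R) := (expR (- (r * t)))%:E * phi (X (Num.max 0 t)%R w).
have mf : measurable_fun setT f.
  have H := measurable_fun_discounted_path (measurable_path DX) mphi.
  exact: (measurableT_comp H (measurable_pair1 w)).
have f0 t : 0 <= f t by rewrite mule_ge0// lee_fin expR_ge0.
transitivity (\int[mu]_(t in `[a, +oo[) f t).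
  apply: eq_integral => t; rewrite inE/= in_itv/= andbT => at_.
  by rewrite /f max_r// (le_trans a0).
rewrite -ge0_integral_shift// -ge0_integralZl_EFin ?expR_ge0//.
- apply: eq_integral => t; rewrite inE/= in_itv/= andbT => t0.
  by rewrite /f max_r ?addr_ge0// muleA -EFinM -expRD mulrDr opprD.
- by move=> t _; rewrite mule_ge0// lee_fin expR_ge0.
- apply: (@eq_measurable_fun _ _ _ _ _ (fun s => (expR (- (r * s)))%:E *
     phi (X (Num.max 0 (a + Num.max 0 s))%R w))).
    move=> t; rewrite inE/= in_itv/= andbT => t0.
    by rewrite (max_r t0) max_r// addr_ge0.
  apply: measurable_funTS; apply: emeasurable_funM.
    by apply/measurable_EFinP; exact: measurable_expRN.
  have Hp : measurable_fun setT ((fun p : R * Omega => X (Num.max 0 p.1)%R p.2) \o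
      (fun s : R => (a + Num.max 0 s, w)%R)).
    apply: measurableT_comp; first exact: (measurable_path DX).
    apply: measurable_fun_pair => //; apply: measurable_funD => //.
    exact: measurable_maxr.
  exact: (measurableT_comp mphi Hp).
Qed.

End nonnegative.

Lemma measurable_Xtau (tau : Omega -> \bar R) : stopping_time X P tau ->
  measurable_fun setT (fun w => X (fine (tau w)) w).
Proof.
move=> st; have := measurable_X_stopped DX st (lexx 0%R).
by under eq_fun do rewrite addr0.
Qed.

(** [diffusion_strong_markov] is the case of an indicator; linearity and monotone convergence do the
    rest. *)
Lemma strong_markov_integral (tau : Omega -> \bar R) (A : set Omega) (x : E) (s : R)
    (phi : E -> \bar R) :
  stopping_time X P tau -> stopped_events X P tau A ->
  A `<=` [set w | tau w < +oo] -> (0 <= s)%R ->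
  measurable_fun setT phi -> (forall y, 0 <= phi y) ->
  \int[P x]_(w in A) phi (X (fine (tau w) + s)%R w) =
  \int[P x]_(w in A) \int[P (X (fine (tau w)) w)]_v phi (X s v).
Proof.
move=> st FA Atau s0.
have mA := FA.1.
have mXs := measurable_X_stopped DX st s0.
have mXt := measurable_Xtau st.
have mXsn := measurable_X_natural (X := X) s0.
have mXss := measurable_X DX s0.
have mk (psi : E -> \bar R) : measurable_fun setT psi -> (forall y, 0 <= psi y) ->
    measurable_fun A (fun w => \int[P (X (fine (tau w)) w)]_v psi (X s v)).
  move=> mpsi psi0; apply: measurable_funTS.
  have H := @measurable_integral_P_cst (psi \o X s) (measurableT_comp mpsi mXsn)
    (fun v => psi0 (X s v)).
  exact: (measurableT_comp H mXt).
have ml (psi : E -> \bar R) : measurable_fun setT psi ->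
    measurable_fun A (fun w => psi (X (fine (tau w) + s)%R w)).
  move=> mpsi; have H := measurableT_comp mpsi mXs.
  exact: (measurable_funTS H).
move: phi; apply: ge0_measurable_ind.
- move=> B mB.
  have := diffusion_strong_markov DX st FA s0 mB x.
  rewrite (setIidl Atau) => sm.
  have mpre (Z : Omega -> E) : measurable_fun setT Z -> measurable (Z @^-1` B).
    by move=> mZ; rewrite -[X in measurable X]setTI; exact: mZ.
  have mB' := mpre _ mXs.
  transitivity (\int[P x]_(w in A) (\1_[set w | B (X (fine (tau w) + s)%R w)] w)%:E).
    by apply: eq_integral => w _ /=; rewrite !indicE; congr (_%:R%:E); apply/idP/idP; rewrite !inE.
  rewrite integral_indic// (setIC _ A). apply: (etrans sm); apply: eq_integral => w _.
  transitivity (\int[P (X (fine (tau w)) w)]_v (\1_(X s @^-1` B) v)%:E).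
    by rewrite integral_indic ?setIT//; exact: mpre.
  by apply: eq_integral => v _ /=; rewrite !indicE; congr (_%:R%:E); apply/idP/idP; rewrite !inE.
- move=> c f c0 mf f0 IH.
  have mfX : measurable_fun [set: Omega] (fun v => f (X s v)).
    exact: (measurableT_comp mf mXss).
  rewrite ge0_integralZl_EFin//; last exact: ml.
  rewrite IH -ge0_integralZl_EFin//; last exact: mk.
    by apply: eq_integral => w _; rewrite ge0_integralZl_EFin.
  by move=> w _; exact: integral_ge0.
- move=> f g mf f0 mg g0 IHf IHg.
  have mfX : measurable_fun [set: Omega] (fun v => f (X s v)).
    exact: (measurableT_comp mf mXss).
  have mgX : measurable_fun [set: Omega] (fun v => g (X s v)).
    exact: (measurableT_comp mg mXss).
  rewrite ge0_integralD//; [|exact: ml|exact: ml].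
  rewrite IHf IHg -ge0_integralD//.
  + by apply: eq_integral => w _; rewrite ge0_integralD.
  + by move=> w _; exact: integral_ge0.
  + exact: mk.
  + by move=> w _; exact: integral_ge0.
  + exact: mk.
- move=> F mF F0 ndF IH.
  have mFX i : measurable_fun [set: Omega] (fun v => F i (X s v)).
    exact: (measurableT_comp (mF i) mXss).
  rewrite monotone_convergence//; last by move=> i; exact: ml.
  under eq_fun do rewrite IH.
  rewrite -monotone_convergence//.
  + by apply: eq_integral => w _; rewrite monotone_convergence// => v _; exact: ndF.
  + by move=> i; exact: mk.
  + by move=> i w _; exact: integral_ge0.
  + by move=> w _ i j ij; apply: ge0_le_integral => // v _; exact: ndF.
Qed.

(* [tail phi tau] is [exp (- r tau)] times the integral of [phi] along the path
   shifted by [tau], whose conditional expectation is the potential at [X_tau]. *)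
Lemma stopped_potential (tau : Omega -> \bar R) (A : set Omega) (x : E)
    (phi : E -> \bar R) : (0 < r)%R ->
  stopping_time X P tau -> stopped_events X P tau A ->
  A `<=` [set w | tau w < +oo] ->
  measurable_fun setT phi -> (forall y, 0 <= phi y) ->
  \int[P x]_(w in A) ((expR (- (r * fine (tau w))))%:E *
    potential phi (X (fine (tau w)) w)) =
  \int[P x]_(w in A) tail phi (fine (tau w)) w.
Proof.
move=> r_gt0 st FA Atau mphi phi0.
have mA := FA.1.
have mtau := measurable_stopping_time DX st.
have mft : measurable_fun setT (fun w => fine (tau w)).
  by apply: measurableT_comp => //; exact: fine_measurable.
have ft0 w : (0 <= fine (tau w))%R by exact: fine_stopping_ge0 st.
have mXt := measurable_Xtau st.
pose shifted (w : Omega) := \int[mu]_(s in `[0%R, +oo[)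
  ((expR (- (r * s)))%:E * phi (X (fine (tau w) + s)%R w)).
pose f (p : Omega * R) := (expR (- (r * p.2)))%:E *
  phi (X (fine (tau p.1) + Num.max 0 p.2)%R p.1).
have e0 (s : R) : 0 <= (expR (- (r * s)))%:E by rewrite lee_fin expR_ge0.
have mf : measurable_fun setT f.
  apply: emeasurable_funM.
    apply/measurable_EFinP.
    exact: (measurableT_comp (measurable_expRN r) measurable_snd).
  have Hp : measurable_fun setT ((fun p : R * Omega => X (Num.max 0 p.1)%R p.2) \o
      (fun p : Omega * R => (fine (tau p.1) + Num.max 0 p.2, p.1)%R)).
    apply: measurableT_comp; first exact: (measurable_path DX).
    apply: measurable_fun_pair => //; apply: measurable_funD => //.
      exact: (measurableT_comp mft measurable_fst).
    exact: measurable_maxr.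
  apply: (@eq_measurable_fun _ _ _ _ _ _ _ _ (measurableT_comp mphi Hp)).
  by move=> p _ /=; rewrite max_r// addr_ge0// le_max lexx.
have f0 p : 0 <= f p by rewrite mule_ge0.
pose g (p : Omega * R) := (expR (- (r * p.2)))%:E *
  \int[P (X (fine (tau p.1)) p.1)]_v phi (X (Num.max 0 p.2)%R v).
have mg : measurable_fun setT g.
  apply: emeasurable_funM.
    apply/measurable_EFinP.
    exact: (measurableT_comp (measurable_expRN r) measurable_snd).
  apply: (@measurable_integral_P _ (Omega * R)%type
    (fun p => X (fine (tau p.1)) p.1)
    (fun q => phi (X (Num.max 0 q.1.2)%R q.2))) => //.
    exact: (measurableT_comp mXt measurable_fst).
  have Hp : measurable_fun setT ((fun p : R * natural_space X => X (Num.max 0 p.1)%R p.2) \o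
      (fun q : (Omega * R) * natural_space X => (q.1.2, q.2))).
    apply: measurableT_comp; first exact: (measurable_path_natural DX).
    apply: measurable_fun_pair => //.
    exact: (measurableT_comp measurable_snd measurable_fst).
  exact: (measurableT_comp mphi Hp).
have g0 p : 0 <= g p by rewrite mule_ge0//; exact: integral_ge0.
(* Multiplying the tail by [exp (r tau)] undoes the discount in [tail_shift]. *)
have mshifted : measurable_fun setT shifted.
  apply: (@eq_measurable_fun _ _ _ _ _
    (fun w => (expR (r * fine (tau w)))%:E * tail phi (fine (tau w)) w)).
    move=> w _; rewrite tail_shift// muleA -EFinM -expRD addrN expR0 mul1e.
    by [].
  apply: emeasurable_funM.
    apply/measurable_EFinP; apply: (measurableT_comp (@measurable_expR R)).
    exact: measurable_funM.
  exact: (measurable_fun_tail (measurable_path DX) mphi phi0 mft ft0).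
have shifted0 w : 0 <= shifted w by apply: integral_ge0 => s _; rewrite mule_ge0.
(* The identity without its weight: Tonelli isolates a fixed time [s], where
   [strong_markov_integral] applies on [B], and further exchanges reassemble the potential. *)
have key (B : set Omega) : stopped_events X P tau B -> B `<=` A ->
    \int[P x]_(w in B) shifted w = \int[P x]_(w in B) potential phi (X (fine (tau w)) w).
  move=> FB BA; have mB := FB.1.
  transitivity (\int[P x]_(w in B) \int[mu]_(s in `[0%R, +oo[) f (w, s)).
    apply: eq_integral => w _; apply: eq_integral => s.
    by rewrite inE/= in_itv/= andbT => s0; rewrite /f/= max_r.
  rewrite (ge0_integral_swap (P x) mu mB (measurable_itv _) mf f0).
  transitivity (\int[P x]_(w in B) \int[mu]_(s in `[0%R, +oo[) g (w, s)).
    rewrite (ge0_integral_swap (P x) mu mB (measurable_itv _) mg g0).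
    apply: eq_integral => s; rewrite inE/= in_itv/= andbT => s0.
    rewrite /f /g /= max_r// !ge0_integralZl_EFin ?expR_ge0//.
    + by congr (_ * _); apply: strong_markov_integral => //; exact: subset_trans Atau.
    + by move=> w _; exact: integral_ge0.
    + have H := @measurable_integral_P_cst (phi \o X s)
        (measurableT_comp mphi (measurable_X_natural (X := X) s0)) (fun v => phi0 (X s v)).
      exact: (measurable_funTS (measurableT_comp H mXt)).
    + exact: (measurable_funTS (measurableT_comp mphi (measurable_X_stopped DX st s0))).
  apply: eq_integral => w _; rewrite /potential /tail.
  transitivity (\int[mu]_(s in `[0%R, +oo[)
    \int[P (X (fine (tau w)) w)]_v ((expR (- (r * s)))%:E * phi (X (Num.max 0 s)%R v))).
    apply: eq_integral => s _; rewrite /g/= -ge0_integralZl_EFin ?expR_ge0//.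
    apply: (measurableT_comp mphi); apply: (measurable_X DX).
    by rewrite le_max lexx.
  have mh := measurable_fun_discounted_path (measurable_path DX) mphi.
  rewrite -(ge0_integral_swap (P (X (fine (tau w)) w)) mu measurableT (measurable_itv _) mh);
    last by move=> z; rewrite mule_ge0.
  apply: eq_integral => v _; apply: eq_integral => s.
  by rewrite inE/= in_itv/= andbT => s0; rewrite max_r.
transitivity (\int[P x]_(w in A) ((expR (- (r * fine (tau w))))%:E * shifted w)).
  have mpot : measurable_fun setT (fun w => potential phi (X (fine (tau w)) w)).
    exact: (measurableT_comp (measurable_potential mphi phi0) mXt).
  (* Both weighted integrals become mixtures of unweighted ones over [A] intersected with
     [tau <= c], to which [key] applies. *)
  have L1 := layer_cake r_gt0 (P x) mA mft ft0 mpot (fun w => potential_ge0 _ phi0).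
  have L2 := layer_cake r_gt0 (P x) mA mft ft0 mshifted shifted0.
  apply: (etrans L1); apply: (etrans _ (esym L2)).
  apply: eq_integral => c; rewrite inE/= in_itv/= andbT => c0; congr (_ * _).
  (* [fine] sends [+oo] to 0, so the two conditions agree only because [tau] is finite on [A]. *)
  have e : A `&` [set w | (fine (tau w) <= c)%R] = A `&` [set w | tau w <= c%:E].
    apply/seteqP; split => w /= [Aw h]; split => //; move: h;
      have := Atau _ Aw => /=; have [+ _] := st => /(_ w); case: (tau w) => //.
  rewrite e key//; first by apply: stopped_events_le.
by apply: eq_integral => w _; rewrite tail_shift.
Qed.

End potential_theory.

(** * The Green kernel and inequalities for potentials *)

Section green_kernel.
Local Open Scope ereal_scope.
Context (R : realType) (n : nat) (dO : measure_display) (Omega : measurableType dO).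
Context (X : R -> Omega -> euclid R n) (P : euclid R n -> probability Omega R).
Hypothesis DX : diffusion X P.
Context (r : R).
Local Notation E := (euclid R n).
Local Notation mu := (@lebesgue_measure R).
Local Notation potential := (potential X P r).
Local Notation tail := (tail X r).

Section green_density.
Variable y : E.

(* [green X P r y] is the image of the measure with density [k] with respect to
   the product of [P y] and Lebesgue measure under the map [Y]. *)
Let k (p : Omega * R) : R := (\1_(`[0%R, +oo[%classic : set R) p.2 * expR (- (r * p.2)))%R.
Let Y (p : Omega * R) : E := X (Num.max 0 p.2)%R p.1.

Let mk : measurable_fun setT k.
Proof.
apply: measurable_funM; last exact: (measurableT_comp (measurable_expRN r) measurable_snd).
by apply: (measurableT_comp _ measurable_snd); exact: measurable_indic.
Qed.

Let mY : measurable_fun setT Y.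
Proof.
by apply: (measurableT_comp (g := fun p : Omega * R => (p.2, p.1)) (measurable_path DX));
  exact: measurable_fun_pair.
Qed.

Let k0 p : (0 <= k p)%R.
Proof. by rewrite mulr_ge0 ?expR_ge0. Qed.

Let mint (psi : E -> \bar R) : measurable_fun setT psi ->
  measurable_fun setT (fun p => (k p)%:E * psi (Y p)).
Proof.
by move=> mpsi; apply: emeasurable_funM; [exact/measurable_EFinP|exact: (measurableT_comp mpsi mY)].
Qed.

Let int0 (psi : E -> \bar R) : (forall y, 0 <= psi y) -> forall p, 0 <= (k p)%:E * psi (Y p).
Proof. by move=> psi0 p; rewrite mule_ge0// lee_fin. Qed.

Let greenE H : measurable H ->
  green X P r y H = \int[P y \x mu]_(p in Y @^-1` H) (k p)%:E.
Proof.
move=> mH.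
have mYH : measurable (Y @^-1` H) by rewrite -[X in measurable X]setTI; exact: mY.
transitivity (\int[P y \x mu]_p ((k p)%:E * (EFin \o \1_H) (Y p))); last first.
  rewrite [RHS]integral_mkcond; apply: eq_integral => p _.
  rewrite patchE /= indicE; have -> : (p \in Y @^-1` H) = (Y p \in H).
    by apply/idP/idP; rewrite !inE.
  by case: ifP => _; rewrite ?mule1 ?mule0.
have mH1 : measurable_fun setT (EFin \o \1_H : E -> \bar R).
  exact/measurable_EFinP/measurable_indic.
have H10 z : 0 <= (EFin \o \1_H : E -> \bar R) z by rewrite lee_fin.
apply/esym; apply: (etrans (fubini_tonelli2 (m1 := P y) (m2 := mu) _ (mint mH1) (int0 H10))).
apply/esym; rewrite /green [LHS]integral_mkcond.
apply: eq_integral => t _; rewrite patchE /fubini_G /k /Y /=.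
case: ifPn => [|tn]; last first.
  by rewrite integral0_eq// => w _; rewrite indicE (negbTE tn) mul0r mul0e.
move=> tin; have := tin; rewrite inE/= in_itv/= andbT => t0.
have mXt : measurable (X t @^-1` H).
  by rewrite -[X in measurable X]setTI; exact: (measurable_X DX t0).
rewrite -[in LHS](setIT (X t @^-1` H)) -integral_indic// -ge0_integralZl_EFin ?expR_ge0//.
- apply: eq_integral => w _; rewrite !indicE tin mul1r max_r//.
- exact/measurable_EFinP/measurable_indic.
Qed.

Lemma green_measure : exists m : {measure set E -> \bar R},
  forall H, measurable H -> green X P r y H = m H.
Proof. exact: (@density_measure _ _ _ _ _ (P y \x mu) _ Y k mY mk k0 greenE). Qed.

(** Tonelli with time as the inner variable yields the potential; [greenE] uses the other order. *)
Lemma green_integral (phi : E -> \bar R) :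
  measurable_fun setT phi -> (forall y, 0 <= phi y) ->
  \int[green X P r y]_z phi z = potential phi y.
Proof.
move=> mphi phi0.
apply: (etrans (@ge0_integral_density _ _ _ _ _ (P y \x mu) _ Y k mY mk k0 greenE _ mphi phi0)).
apply: (etrans (fubini_tonelli1 (m1 := P y) (m2 := mu) _ (mint mphi) (int0 phi0))).
apply: eq_integral => w _.
rewrite /fubini_F [RHS]integral_mkcond; apply: eq_integral => t _.
rewrite patchE /k /Y /= indicE; case: ifPn => [|_]; last by rewrite mul0r mul0e.
by rewrite inE/= in_itv/= andbT => t0; rewrite mul1r max_r.
Qed.

End green_density.

Lemma stopped_events_lty (tau : Omega -> \bar R) : stopping_time X P tau ->
  stopped_events X P tau [set w | tau w < +oo].
Proof.
move=> st; split; first exact: (measurable_stopping_lty DX).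
move=> t t0; rewrite (_ : _ `&` _ = [set w | tau w <= t%:E]); first exact: st.2.
by apply/seteqP; split => w /=; [case|move=> wt; split => //; rewrite (le_lt_trans wt)// ltry].
Qed.

Section positive_rate.
Hypothesis r_gt0 : (0 < r)%R.
Variable phi : E -> \bar R.
Hypotheses (mphi : measurable_fun setT phi) (phi0 : forall y, 0 <= phi y).

Lemma measurable_discounted_trajectory (w : Omega) (a : R) : (0 <= a)%R ->
  measurable_fun `[a, +oo[ (fun t => (expR (- (r * t)))%:E * phi (X t w)).
Proof.
move=> a0.
have H := measurable_fun_discounted_path r (measurable_path DX) mphi.
have H1 := measurable_funTS (D := `[a, +oo[) (measurableT_comp H (measurable_pair1 w)).
apply: eq_measurable_fun H1 => t; rewrite inE/= in_itv/= andbT => at_ /=.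
by rewrite max_r// (le_trans a0).
Qed.

Lemma tail_nonincreasing (a b : R) w : (0 <= a)%R -> (a <= b)%R -> tail phi b w <= tail phi a w.
Proof.
move=> a0 ab; apply: ge0_subset_integral => //.
- exact: measurable_discounted_trajectory.
- by move=> t _; rewrite mule_ge0// lee_fin expR_ge0.
- by move=> t /=; rewrite !in_itv/= !andbT; exact: le_trans.
Qed.

Lemma measurable_tail (a : Omega -> R) : measurable_fun setT a ->
  (forall w, (0 <= a w)%R) -> measurable_fun setT (fun w => tail phi (a w) w).
Proof. exact: (measurable_fun_tail r (measurable_path DX) mphi phi0). Qed.

(** [stopped_potential] turns the left side into the expected tail after [tau], which is at most the
    whole integral of a nonnegative integrand. *)
Lemma stopped_potential_le (tau : Omega -> \bar R) (x : E) : stopping_time X P tau ->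
  \int[P x]_(w in [set w | tau w < +oo]) ((expR (- (r * fine (tau w))))%:E *
    potential phi (X (fine (tau w)) w)) <= potential phi x.
Proof.
move=> st; have Ft := stopped_events_lty st.
have ft0 w : (0 <= fine (tau w))%R by exact: (fine_stopping_ge0 w st).
have mft : measurable_fun setT (fun w => fine (tau w)).
  by apply: measurableT_comp; [exact: fine_measurable|exact: (measurable_stopping_time DX st)].
rewrite [leLHS](stopped_potential DX x r_gt0 st Ft (fun w hw => hw) mphi phi0).
apply: (@le_trans _ _ (\int[P x]_(w in [set w | tau w < +oo]) tail phi 0%R w)).
  apply: ge0_le_integral => //.
  - exact: Ft.1.
  - by move=> w _; exact: tail_ge0.
  - exact/measurable_funTS/measurable_tail.
  - exact/measurable_funTS/measurable_tail.
  - by move=> w _; exact: tail_nonincreasing.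
apply: ge0_subset_integral => //.
- exact: Ft.1.
- exact: measurable_tail.
- by move=> w _; exact: tail_ge0.
Qed.

(* The sets [seqDU B k] are the events that [k] is the first index at which the
   discounted process exceeds [e]; they belong to the filtration at time [t k]. *)
Lemma discounted_maximal_inequality (g : E -> R) (x : E) (t : R^nat) (e : R) :
  measurable_fun setT g -> (forall y, (g y)%:E <= potential phi y) ->
  {homo t : i j / (i <= j)%N >-> (i <= j)%R} -> (0 <= t 0%N)%R -> (0 <= e)%R ->
  e%:E * P x (\bigcup_k [set w | (e < expR (- (r * t k)) * g (X (t k) w))%R]) <=
    \int[P x]_w tail phi (t 0%N) w.
Proof.
move=> mg gphi ndt t00 e0; set B := fun k => _.
have t0 k : (0 <= t k)%R by rewrite (le_trans t00)// ndt.
have nB i k : (i <= k)%N -> natural X `[0%R, t k] (B i).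
  move=> ik; rewrite /B (_ : [set w | _] =
    X (t i) @^-1` [set y | (e < expR (- (r * t i)) * g y)%R])//.
  apply: natural_cylinder; first by rewrite t0 ndt.
  rewrite -[X in measurable X]setTI (_ : [set y | _] =
    (fun y => expR (- (r * t i)) * g y)%R @^-1` `]e, +oo[); last first.
    by apply/seteqP; split => y /=; rewrite in_itv/= andbT.
  have : measurable_fun setT (fun y => expR (- (r * t i)) * g y)%R by exact: measurable_funM.
  by apply => //; exact: measurable_itv.
pose D := seqDU B.
have nD k : natural X `[0%R, t k] (D k).
  rewrite /D /seqDU.
  apply: (@measurableD _ (g_sigma_algebraType _)); first exact: nB.
  apply: (@bigsetU_measurable _ (g_sigma_algebraType _)) => i _.
  by apply: nB; rewrite ltnW.
have FD k : usual_filtration X P (t k) (D k) by apply: natural_usual; exact: nD.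
have mD k : measurable (D k) by exact: (diffusion_complete DX (t0 k) (FD k)).
rewrite seqDU_bigcup_eq -/D -(integral_cst (P x))//; last exact: bigcup_measurable.
rewrite ge0_integral_bigcup//; last exact: trivIset_seqDU.
apply: (@le_trans _ _ (\sum_(k <oo) \int[P x]_(w in D k) tail phi (t 0%N) w)).
  apply: lee_nneseries => [k _|k _ //].
    by move=> _; apply: integral_ge0 => w _; rewrite lee_fin.
  (* On [D k], an event of the filtration at the constant time [t k], [e] is below the discounted
     [g], hence below the discounted potential, and [stopped_potential] converts the latter into a
     tail. *)
  apply: (@le_trans _ _ (\int[P x]_(w in D k) tail phi (t k) w)).
    rewrite -(stopped_potential DX x r_gt0 (stopping_time_cst X P (t0 k))
      (stopped_events_cst DX (t0 k) (FD k)))//; last by move=> w _; exact: ltry.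
    apply: ge0_le_integral => //.
    - apply: measurable_funTS; apply: emeasurable_funM => //=.
      exact: (measurableT_comp (measurable_potential DX r mphi phi0) (measurable_X DX (t0 k))).
    - move=> w [Bw _] /=; apply: (@le_trans _ _ (expR (- (r * t k)) * g (X (t k) w))%:E).
        by rewrite lee_fin ltW.
      by rewrite EFinM lee_wpmul2l// lee_fin expR_ge0.
  apply: ge0_le_integral => //.
  - by move=> w _; exact: tail_ge0.
  - exact/measurable_funTS/measurable_tail.
  - exact/measurable_funTS/measurable_tail.
  - by move=> w _; apply: tail_nonincreasing => //; exact: ndt.
rewrite -ge0_integral_bigcup//.
- apply: ge0_subset_integral => //.
  + exact: bigcup_measurable.
  + exact: measurable_tail.
  + by move=> w _; exact: tail_ge0.
- exact/measurable_funTS/measurable_tail.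
- by move=> w _; exact: tail_ge0.
- exact: trivIset_seqDU.
Qed.

End positive_rate.
End green_kernel.
(** * Discounted rewards at infinity *)

Section vanishing.
Local Open Scope ereal_scope.
Context (R : realType) (n : nat) (dO : measure_display) (Omega : measurableType dO).
Context (X : R -> Omega -> euclid R n) (P : euclid R n -> probability Omega R).
Hypothesis DX : diffusion X P.
Context (r : R).
Hypothesis r_gt0 : (0 < r)%R.
Local Notation E := (euclid R n).
Local Notation mu := (@lebesgue_measure R).
Local Notation potential := (potential X P r).
Local Notation tail := (tail X r).
Variable phi : E -> \bar R.
Hypotheses (mphi : measurable_fun setT phi) (phi0 : forall y, 0 <= phi y).

(** By Tonelli the expected tail is the tail of a convergent time integral of [H]. *)
Lemma expected_tail_small (x : E) (e : R) : (0 < e)%R -> potential phi x < +oo ->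
  exists T : nat, \int[P x]_w tail phi T%:R w <= e%:E.
Proof.
move=> e0 fin.
pose f (p : Omega * R) := (expR (- (r * p.2)))%:E * phi (X (Num.max 0 p.2)%R p.1).
have mf : measurable_fun setT f := measurable_fun_discounted_path r (measurable_path DX) mphi.
have f0 p : 0 <= f p by rewrite mule_ge0// lee_fin expR_ge0.
pose H t := \int[P x]_w f (w, t).
have mH : measurable_fun setT H.
  exact: (measurable_fun_fubini_tonelli_G (m1 := P x) f mf f0).
have H0 t : 0 <= H t by exact: integral_ge0.
have tailE (a : R) : (0 <= a)%R ->
    \int[P x]_w tail phi a w = \int[mu]_(t in `[a, +oo[) H t.
  move=> a0.
  apply: etrans (ge0_integral_swap (P x) mu measurableT (measurable_itv _) mf f0).
  apply: eq_integral => w _; apply: eq_integral => t.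
  by rewrite inE/= in_itv/= andbT => at_; rewrite /f max_r// (le_trans a0).
pose I0 := \int[mu]_(t in `[0%R, +oo[) H t.
have I0fin : I0 \is a fin_num.
  by rewrite ge0_fin_numE ?integral_ge0// /I0 -tailE.
pose J (k : nat) := \int[mu]_(t in `[0%R, k%:R[) H t.
have IJ k : I0 = J k + \int[mu]_(t in `[k%:R, +oo[) H t.
  rewrite /I0 /J -ge0_integral_setU//.
  - congr integral; apply/seteqP; split => t /=; rewrite !in_itv/= !andbT.
      by move=> t0; have [tk|tk] := ltP t k%:R; [left; rewrite t0|right].
    by case=> [/andP[]//|]; exact: le_trans.
  - exact: measurable_funTS.
  - apply/disj_setPRL => t /=; rewrite !in_itv/= andbT => kt.
    by apply/negP; rewrite negb_and -!leNgt kt orbT.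
(* If every tail exceeded [e], the partial integrals [J k] would stay below [I0 - e], against their
   convergence to [I0]. *)
apply: contrapT => /forallNP noT.
have big k : e%:E < \int[mu]_(t in `[k%:R, +oo[) H t.
  by rewrite ltNge -tailE//; exact/negP.
have Jle k : J k <= I0 - e%:E.
  by rewrite leeBrDr// [leRHS](IJ k) leeD2l// ltW.
have cvJ : J @ \oo --> I0.
  rewrite /I0 (_ : `[0%R, +oo[%classic = \bigcup_k `[0%R, k%:R[%classic).
    have ndI : {homo (fun k => `[0%R, k%:R[%classic : set R) : i j / (i <= j)%N >-> (i <= j)%O}.
      move=> i j ij; apply/subsetPset => t /=; rewrite !in_itv/= => /andP[-> ti].
      by rewrite (lt_le_trans ti)// ler_nat.
    exact: (ge0_nondecreasing_set_cvg_integral (mu := mu) ndI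
      (fun k => measurable_itv `[0%R, k%:R[) (fun k => measurable_funTS mH) (fun k t _ => H0 t)).
  apply/seteqP; split => t /=; rewrite in_itv/= ?andbT.
    move=> t0; exists (Num.truncn t).+1 => //=.
    by rewrite in_itv/= t0 truncnS_gt.
  by case=> k _ /=; rewrite in_itv/= => /andP[].
have : I0 <= I0 - e%:E.
  rewrite -{1}(cvg_lim _ cvJ)//; apply: lime_le; last exact: nearW.
  by apply/cvg_ex; exists I0.
by rewrite leeBrDr// -[leRHS]adde0 leeD2lE// lee_fin leNgt e0.
Qed.

Variable g : E -> R.
Hypotheses (g0 : forall y, (0 <= g y)%R) (cg : continuous g).
Hypothesis gphi : forall y, (g y)%:E <= potential phi y.
Hypothesis phi_fin : forall y, potential phi y < +oo.

Let exceeds (j T m k : nat) : set Omega :=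
  [set w | (j.+1%:R^-1 < expR (- (r * (T%:R + k%:R / 2 ^+ m))) * g (X (T%:R + k%:R / 2 ^+ m) w))%R].

(* By continuity of the paths it is enough to look at dyadic times. *)
Definition nonvanishing : set Omega :=
  \bigcup_j \bigcap_T \bigcup_m \bigcup_k exceeds j T m k.

Let time0 (T m k : nat) : (0 <= T%:R + k%:R / 2 ^+ m :> R)%R.
Proof. by rewrite addr_ge0// divr_ge0// exprn_ge0. Qed.

Let natural_exceeds j T m k : natural X `[0%R, +oo[ (exceeds j T m k).
Proof.
rewrite /exceeds; set t : R := (_ + _)%R; set e : R := (_^-1)%R.
have mg := continuous_measurable_euclid cg.
have mh : measurable_fun setT (fun y => expR (- (r * t)) * g y)%R by exact: measurable_funM.
have := @measurable_X_natural _ _ _ _ X t (time0 T m k) measurableT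
  ((fun y => expR (- (r * t)) * g y)%R @^-1` `]e, +oo[).
rewrite setTI (_ : X t @^-1` _ = [set w | (e < expR (- (r * t)) * g (X t w))%R]).
  by apply; rewrite -[X in measurable X]setTI; exact: mh.
by apply/seteqP; split => w /=; rewrite in_itv/= andbT.
Qed.

Let natural_exceedsT j T : natural X `[0%R, +oo[ (\bigcup_m \bigcup_k exceeds j T m k).
Proof.
apply: (@bigcup_measurable _ (natural_space X)) => m _.
by apply: (@bigcup_measurable _ (natural_space X)) => k _; exact: natural_exceeds.
Qed.

Let natural_exceedsI j : natural X `[0%R, +oo[ (\bigcap_T \bigcup_m \bigcup_k exceeds j T m k).
Proof.
apply: (@bigcap_measurable _ (natural_space X)); first by exists 0%N.
by move=> T _; exact: natural_exceedsT.
Qed.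

(** Membership in the natural sigma-algebra lets this event serve as a null event in [null_sets]. *)
Lemma natural_nonvanishing : natural X `[0%R, +oo[ nonvanishing.
Proof.
by apply: (@bigcup_measurable _ (natural_space X)) => j _; exact: natural_exceedsI.
Qed.

Lemma nonvanishing_eq0 (x : E) : P x nonvanishing = 0.
Proof.
have mN := natural_measurable DX natural_nonvanishing.
apply/(@negligibleP _ _ _ (P x) _ mN); apply: negligible_bigcup => j.
have mI := natural_measurable DX (natural_exceedsI j).
apply/(@negligibleP _ _ _ (P x) _ mI)/eqP; rewrite eq_le measure_ge0 andbT.
apply/lee_addgt0Pr => e e0; rewrite add0e.
have j0 : (0 < j.+1%:R^-1 :> R)%R by rewrite invr_gt0.
(* The factor [1/(j+1)] will cancel against the threshold in the maximal inequality and leave the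
   bound [e]. *)
have [T HT] := expected_tail_small (mulr_gt0 j0 e0) (phi_fin x).
have mT := natural_measurable DX (natural_exceedsT j T).
apply: (@le_trans _ _ (P x (\bigcup_m \bigcup_k exceeds j T m k))).
  by apply: le_measure; rewrite ?inE//; exact: bigcap_inf.
pose F m := \bigcup_k exceeds j T m k.
have mF m : measurable (F m).
  by apply: bigcup_measurable => k _; exact: (natural_measurable DX (natural_exceeds _ _ _ _)).
(* The dyadic grids are nested, as [k / 2^m = 2k / 2^(m+1)]. Continuity from below then reduces the
   bound to one grid at a time. *)
have ndF : {homo F : i k / (i <= k)%N >-> (i <= k)%O}.
  apply/nondecreasing_seqP => m; apply/subsetPset => w [k _ kw].
  exists (k * 2)%N => //; rewrite /exceeds /=.
  have -> // : ((k * 2)%:R / 2 ^+ m.+1 = k%:R / 2 ^+ m :> R)%R.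
  by rewrite natrM exprSr invfM mulrACA divff ?mulr1.
have cvF := nondecreasing_cvg_mu (mu := P x) mF mT ndF.
rewrite -(cvg_lim _ cvF)//; apply: lime_le; first by apply/cvg_ex; eexists; exact: cvF.
apply: nearW => m /=.
pose t k : R := (T%:R + k%:R / 2 ^+ m)%R.
have ndt : {homo t : i k / (i <= k)%N >-> (i <= k)%R}.
  by move=> i k ik; rewrite lerD2l ler_wpM2r ?invr_ge0 ?exprn_ge0// ler_nat.
have := discounted_maximal_inequality DX r_gt0 mphi phi0 x
  (continuous_measurable_euclid cg) gphi ndt (time0 T m 0%N) (ltW j0).
rewrite (_ : t 0%N = T%:R) => [Hmax|]; last by rewrite /t mul0r addr0.
have := le_trans Hmax HT.
by rewrite EFinM lee_pmul2l// lte_fin.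
Qed.

Lemma vanishing (w : Omega) : ~ nonvanishing w ->
  forall e : R, (0 < e)%R -> exists T : nat, forall t : R, (T%:R <= t)%R ->
    (expR (- (r * t)) * g (X t w) <= e)%R.
Proof.
move=> nNw e e0.
have [j ltje] : exists j : nat, (j.+1%:R^-1 < e :> R)%R.
  have [j _ /(_ _ (leqnn j)) /=] := near_infty_natSinv_lt (PosNum e0).
  by exists j.
have [T nT] : exists T, ~ (\bigcup_m \bigcup_k exceeds j T m k) w.
  apply: contrapT => /forallNP h; apply: nNw; exists j => // T _.
  exact: contrapT (h T).
exists T => t Tt; apply: contrapT => /negP; rewrite -ltNge => lte.
pose y (s : R) : R := (expR (- (r * s)) * g (X s w))%R.
have cy : {within `[0%R, +oo[, continuous y}.
  apply/subspace_continuousP => s s0.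
  have s0' : (0 <= s)%R by move: s0; rewrite /= in_itv/= andbT.
  have cX := within_itv_cvg (@diffusion_path _ _ _ _ _ _ DX w) s0'.
  apply: cvgM.
    apply: cvg_within_filter.
    apply: (@continuous_comp _ _ _ (fun s => - (r * s))%R (@expR R)).
      by apply: continuousN; exact: mulrl_continuous.
    exact: continuous_expR.
  by apply: (cvg_comp (fun s => X s w) g cX); exact: cg.
have t0 : (0 <= t)%R by apply: le_trans Tt.
(* A value above [e] at the real time [t] forces values above [1/(j+1)] at all nonnegative times
   within [d] of [t]. *)
have [d d0 Hd] := within_nbhsP cy t0
  (open_nbhs_nbhs (conj (@open_gt R j.+1%:R^-1) (lt_trans ltje lte))).
have [m md] : exists m : nat, ((2 ^+ m)^-1 < d :> R)%R.
  have [m _ /(_ _ (leqnn m)) /=] := near_infty_natSinv_lt (PosNum d0).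
  move=> hm; exists m; apply: le_lt_trans hm.
  by rewrite lef_pV2 ?posrE ?exprn_gt0// -natrX ler_nat ltn_expl.
(* Rounding [t - T] down to the grid gives a dyadic time in [[T, t]] within [d] of [t]. *)
apply: nT; exists m => //; pose k := Num.truncn ((t - T%:R) * 2 ^+ m)%R.
exists k => //; rewrite /exceeds /=; apply: (Hd (T%:R + k%:R / 2 ^+ m)%R) => //.
have p0 : (0 < 2 ^+ m :> R)%R by rewrite exprn_gt0.
have h1 : (k%:R <= (t - T%:R) * 2 ^+ m)%R by rewrite truncn_le mulr_ge0 ?subr_ge0// ltW.
have h2 : ((t - T%:R) * 2 ^+ m < k.+1%:R)%R by exact: truncnS_gt.
rewrite opprD addrA ger0_norm; last by rewrite subr_ge0 ler_pdivrMr.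
apply: lt_trans md; rewrite ltrBlDr -[X in (_ < X + _)%R]mul1r -mulrDl nat1r.
by rewrite ltr_pdivlMr.
Qed.

(** [nonvanishing] is null under every initial law, so completeness applies. This handles the reward
    at infinity, a limsup over uncountably many times. *)
Lemma measurable_sub_nonvanishing (A : set Omega) : A `<=` nonvanishing -> measurable A.
Proof.
move=> AN; apply: (diffusion_complete DX (lexx 0%R)) => s _ pi _.
apply: sub_sigma_algebra; right; exists nonvanishing; split => //.
  exact: natural_nonvanishing.
by rewrite integral0_eq// => x _; exact: nonvanishing_eq0.
Qed.

End vanishing.
(** * Optimal stopping *)

Section stopping_reward.
Local Open Scope ereal_scope.
Context (R : realType) (n : nat) (dO : measure_display) (Omega : measurableType dO).
Context (X : R -> Omega -> euclid R n) (P : euclid R n -> probability Omega R).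
Hypothesis DX : diffusion X P.
Context (r : R).
Hypothesis r_gt0 : (0 < r)%R.
Local Notation E := (euclid R n).
Local Notation potential := (potential X P r).

(** Off the null event [N] discounted rewards tend to 0, so paths with [tau = +oo] contribute
    nothing. *)
Lemma expected_reward_finite (phi : E -> \bar R) (g : E -> R) (tau : Omega -> \bar R) x :
  measurable_fun setT phi -> (forall y, 0 <= phi y) ->
  (forall y, (0 <= g y)%R) -> continuous g ->
  (forall y, (g y)%:E <= potential phi y) -> (forall y, potential phi y < +oo) ->
  stopping_time X P tau ->
  expected_reward X P r g tau x = \int[P x]_(w in [set w | tau w < +oo])
    ((expR (- (r * fine (tau w))))%:E * (g (X (fine (tau w)) w))%:E).
Proof.
move=> mphi phi0 g0 cg gphi phi_fin st.
pose A := [set w | tau w < +oo].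
have mA : measurable A := measurable_stopping_lty DX st.
pose N := nonvanishing X r g.
have mN : measurable N := natural_measurable DX (natural_nonvanishing (X := X) r cg).
pose F0 (w : Omega) : \bar R := (expR (- (r * fine (tau w))))%:E * (g (X (fine (tau w)) w))%:E.
have mft : measurable_fun setT (fun w => fine (tau w)).
  by apply: measurableT_comp; [exact: fine_measurable|exact: (measurable_stopping_time DX st)].
have mF0 : measurable_fun setT F0.
  apply: emeasurable_funM; apply/measurable_EFinP.
    exact: (measurableT_comp (measurable_expRN r) mft).
  exact: (measurableT_comp (continuous_measurable_euclid cg) (measurable_Xtau DX st)).
have F00 w : 0 <= F0 w by rewrite mule_ge0// lee_fin ?expR_ge0.
pose F := reward_at X r g tau.
have disc0 t w : 0 <= discounted_reward X r g t w.
  by rewrite lee_fin mulr_ge0 ?expR_ge0.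
have F_ge0 w : 0 <= F w.
  rewrite /F /reward_at; case: (tau w) => [t| |] //.
  by apply: limf_esup_ge0 => //; exact: filter_not_empty.
have FF0 w : ~ N w -> F w = (F0 \_ A) w.
  move=> Nw; rewrite patchE; case: ifPn => [|nA].
    rewrite inE /A /= /F /F0 /reward_at => taufin; have := st.1 w.
    by case: (tau w) taufin.
  have tauy : tau w = +oo.
    by apply/eqP; rewrite -leye_eq leNgt; apply: contra nA; rewrite inE.
  apply/eqP; rewrite eq_le F_ge0 andbT /F /reward_at tauy limf_esupE.
  apply/lee_addgt0Pr => e e0; rewrite add0e.
  have [T HT] := vanishing DX cg Nw e0.
  apply: (@le_trans _ _ (ereal_sup (discounted_reward X r g ^~ w @` [set t | (T%:R <= t)%R]))).
    apply: ereal_inf_lbound; exists [set t | (T%:R <= t)%R] => //.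
    exact: nbhs_pinfty_ge.
  by apply: ge_ereal_sup => _ [t Tt <-]; rewrite lee_fin; exact: HT.
have mF0A : measurable_fun setT (F0 \_ A).
  by apply/(measurable_restrictT _ mA); exact: measurable_funTS.
(* Off [N] the reward is the measurable [F0 \_ A]; inside [N] every subset is measurable. *)
have mF : measurable_fun setT F.
  move=> _ B mB; rewrite setTI.
  rewrite (_ : F @^-1` B = ((F0 \_ A) @^-1` B `&` ~` N) `|` (F @^-1` B `&` N)).
    apply: measurableU; last first.
      by apply: (measurable_sub_nonvanishing DX r_gt0 mphi phi0 cg gphi phi_fin) => w [].
    apply: measurableI; last exact: (measurableC mN).
    by rewrite -[X in measurable X]setTI; exact: mF0A.
  apply/seteqP; split => w /=.
    by move=> FB; have [Nw|Nw] := pselect (N w); [right|left; rewrite -FF0].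
  by case=> [[h Nw]|[]//]; rewrite FF0.
rewrite /expected_reward [RHS]integral_mkcond; apply: ge0_ae_eq_integral => //.
  by move=> w _; apply: erestrict_ge0 => v _; exact: F00.
exists N; split => //.
  exact: (nonvanishing_eq0 DX r_gt0 mphi phi0 cg gphi phi_fin).
by move=> w /= /not_implyP[_ h]; apply: contrapT => /FF0.
Qed.

Section hitting.
Variables (C : set E) (w : Omega).
Local Notation h := (hitting_time X C w).

Lemma hitting_time_gt (t : R) : (0 <= t)%R -> t%:E < h -> ~ C (X t w).
Proof.
move=> t0 th Ct; move: th; rewrite ltNge => /negP; apply.
by apply: ereal_inf_lbound; exists t.
Qed.

(** The infimum is approached by visits to [C] at or shortly after [h0], and the path is
    continuous. *)
Lemma closure_hitting (h0 : R) : h = h0%:E -> (0 <= h0)%R -> closure C (X h0 w).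
Proof.
move=> hE h00 U /(within_nbhsP (@diffusion_path _ _ _ _ _ _ DX w) h00)[e e0 He].
have : h < (h0 + e)%:E by rewrite hE lte_fin ltrDl.
move=> /ereal_inf_lt[_ [t [t0 Ct] <-]]; rewrite lte_fin => th.
have h0t : (h0 <= t)%R by rewrite -lee_fin -hE; apply: ereal_inf_lbound; exists t.
exists (X t w); split => //; apply: He => //.
by rewrite distrC ger0_norm ?subr_ge0// ltrBlDl.
Qed.

Lemma closure_before (D : set E) (h0 : R) : (0 < h0)%R ->
  (forall t, (0 <= t)%R -> (t < h0)%R -> D (X t w)) -> closure D (X h0 w).
Proof.
move=> h00 HD U /(within_nbhsP (@diffusion_path _ _ _ _ _ _ DX w) (ltW h00))[e e0 He].
(* A nonnegative time before [h0] and within [e] of it. *)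
pose s := Num.max 0%R (h0 - e / 2)%R.
have s0 : (0 <= s)%R by rewrite le_max lexx.
have sh : (s < h0)%R by rewrite gt_max h00/= ltrBlDr ltrDl divr_gt0.
exists (X s w); split; first exact: HD.
apply: He => //; rewrite ger0_norm ?subr_ge0 ?(ltW sh)//.
apply: (@le_lt_trans _ _ (e / 2)%R); last by rewrite ltr_pdivrMr// ltr_pMr// ltr1n.
by rewrite lerBlDr -lerBlDl le_max lexx orbT.
Qed.

End hitting.

End stopping_reward.

(** * Verification of the candidate value function *)

Lemma eq_fin_num_sube0 (R : realType) (p q : \bar R) :
  p = q -> q \is a fin_num -> (p - q = 0)%E.
Proof. by move=> -> fin; exact: subee. Qed.

Lemma fin_num_addB_eq (R : realType) (a p q : \bar R) :
  a \is a fin_num -> p \is a fin_num -> q \is a fin_num ->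
  a = (a + (p - q))%E -> p = q.
Proof.
move: a p q => [a| |] [p| |] [q| |] // _ _ _ [e]; congr EFin; apply/eqP.
by rewrite -subr_eq0; apply/eqP/(@addrI _ a); rewrite addr0 -e.
Qed.

Section green_optimal_stopping.
Local Open Scope ereal_scope.
Context (R : realType) (n : nat) (dO : measure_display) (Omega : measurableType dO).
Context (X : R -> Omega -> euclid R n) (P : euclid R n -> probability Omega R).
Hypothesis DX : diffusion X P.
Context (r : R).
Hypothesis r_gt0 : (0 < r)%R.
Local Notation E := (euclid R n).
Local Notation potential := (potential X P r).

(** The path avoids [C] before the hitting time, so the tail from that time is already the whole
    integral; if [C] is never hit, the whole integral is 0. *)
Lemma potential_hitting (C : set E) (phi : E -> \bar R) x : measurable C ->
  measurable_fun setT phi -> (forall y, 0 <= phi y) -> (forall y, ~ C y -> phi y = 0) ->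
  \int[P x]_(w in [set w | hitting_time X C w < +oo])
    ((expR (- (r * fine (hitting_time X C w))))%:E *
      potential phi (X (fine (hitting_time X C w)) w)) = potential phi x.
Proof.
move=> mC mphi phi0 phiC; have st := diffusion_hitting DX mC.
apply: (etrans (stopped_potential DX x r_gt0 st (stopped_events_lty DX st)
  (fun w hw => hw) mphi phi0)).
rewrite [LHS]integral_mkcond; apply: eq_integral => w _.
have h0 := st.1 w.
have zero t : (0 <= t)%R -> t%:E < hitting_time X C w ->
    (expR (- (r * t)))%:E * phi (X t w) = 0.
  by move=> t0 th; rewrite phiC ?mule0//; exact: hitting_time_gt th.
rewrite patchE; case: ifPn => [|hw]; last first.
  have hy : hitting_time X C w = +oo.
    by apply/eqP; rewrite -leye_eq leNgt; apply: contra hw; rewrite inE.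
  rewrite /tail integral0_eq// => t /=; rewrite in_itv/= andbT => t0.
  by apply: zero => //; rewrite hy ltry.
rewrite inE/= => hfin.
have hE : hitting_time X C w = (fine (hitting_time X C w))%:E.
  by rewrite fineK// ge0_fin_numE.
rewrite /tail [LHS]integral_mkcond [RHS]integral_mkcond; apply: eq_integral => t _.
rewrite !patchE !mem_setE !in_itv/= !andbT.
have [ht|th] := leP (fine (hitting_time X C w)) t.
  by rewrite (le_trans _ ht)// fine_ge0.
by case: ifPn => // t0; rewrite zero// hE lte_fin.
Qed.

Variables (f : E -> R) (S : set E).
Hypothesis f_meas : measurable_fun setT f.
Hypothesis f_int : forall x, (green X P r x).-integrable setT (fun y => (f y)%:E).
Hypothesis mS : measurable S.
Hypothesis f_ge0 : forall x, S x -> (0 <= f x)%R.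

Let fE : E -> \bar R := fun y => (f y)%:E.
(** Off [S] the positive and negative parts of [f] are kept apart, since the results on potentials
    concern nonnegative functions. *)
Let fS := fE \_ S.
Let fp := fE^\+ \_ (~` S).
Let fm := fE^\- \_ (~` S).

Let mfE : measurable_fun setT fE. Proof. exact/measurable_EFinP. Qed.

Let mfS : measurable_fun setT fS.
Proof. by apply/(measurable_restrictT _ mS); exact: measurable_funTS. Qed.

Let mfp : measurable_fun setT fp.
Proof.
by apply/(measurable_restrictT _ (measurableC mS))/measurable_funTS; exact: measurable_funepos.
Qed.

Let mfm : measurable_fun setT fm.
Proof.
by apply/(measurable_restrictT _ (measurableC mS))/measurable_funTS; exact: measurable_funeneg.
Qed.

Let fS0 y : 0 <= fS y.
Proof. by apply: erestrict_ge0 => z Sz; rewrite lee_fin f_ge0. Qed.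

Let fp0 y : 0 <= fp y. Proof. by apply: erestrict_ge0 => z _; exact: funepos_ge0. Qed.

Let fm0 y : 0 <= fm y. Proof. by apply: erestrict_ge0 => z _; exact: funeneg_ge0. Qed.

(** Integrability makes all three potentials finite, which later permits cancellation in
    [\bar R]. *)
Lemma green_split x :
  [/\ \int[green X P r x]_(y in S) fE y = potential fS x,
      potential fS x \is a fin_num,
      \int[green X P r x]_(y in ~` S) fE y = potential fp x - potential fm x,
      potential fp x \is a fin_num /\ potential fm x \is a fin_num &
      \int[green X P r x]_y fE y =
        potential fS x + (potential fp x - potential fm x)].
Proof.
have [m mE] := green_measure DX r x.
have im := integral_eq_measure mE.
(* Integrability is given for the set function [green]; unfolding it transfers it to the measure
   [m]. *)
have mint : m.-integrable setT fE.
  apply/integrableP; split; first exact: mfE.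
  by rewrite -im; move: (f_int x); rewrite unlock => /asboolP[].
have mintD D : measurable D -> m.-integrable D fE.
  by move=> mD; exact: integrableS mint.
have mSC := measurableC mS.
have HS : \int[m]_(y in S) fE y = potential fS x.
  by rewrite -(green_integral DX r x mfS fS0) im [LHS]integral_mkcond.
have Hp : \int[m]_(y in ~` S) fE^\+ y = potential fp x.
  by rewrite -(green_integral DX r x mfp fp0) im [LHS]integral_mkcond.
have Hm : \int[m]_(y in ~` S) fE^\- y = potential fm x.
  by rewrite -(green_integral DX r x mfm fm0) im [LHS]integral_mkcond.
have HC : \int[m]_(y in ~` S) fE y = potential fp x - potential fm x.
  by rewrite integralE Hp Hm.
split.
- exact: (etrans (im _ _) HS).
- by rewrite -HS; apply: integrable_fin_num => //; exact: mintD.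
- exact: (etrans (im _ _) HC).
- by rewrite -Hp -Hm; split; apply: integrable_fin_num => //;
    [apply: integrable_funepos|apply: integrable_funeneg] => //; exact: mintD.
- apply: (etrans (im _ _)); rewrite -HS -HC -integral_setU//.
  + by rewrite setUv.
  + by rewrite setUv.
  + by apply/disj_setPS; rewrite setICr.
Qed.

Variable g : E -> R.
Hypotheses (g_ge0 : forall x, (0 <= g x)%R) (g_cont : continuous g).
Hypothesis g_green : forall x, (g x)%:E = \int[green X P r x]_y fE y.
Hypothesis g_boundary : forall x, boundary S x -> potential fS x = (g x)%:E.
Hypothesis g_outside : forall x, ~ S x -> (g x)%:E <= potential fS x.

Let gE x : (g x)%:E = potential fS x + (potential fp x - potential fm x).
Proof. by rewrite g_green; have [] := green_split x. Qed.

Let measurable_stopped_reward (psi : E -> \bar R) (tau : Omega -> \bar R) :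
  stopping_time X P tau -> measurable_fun setT psi ->
  measurable_fun [set w | tau w < +oo]
    (fun w => (expR (- (r * fine (tau w))))%:E * psi (X (fine (tau w)) w)).
Proof.
move=> st mpsi; apply: measurable_funTS; apply: emeasurable_funM.
  apply/measurable_EFinP; apply: (measurableT_comp (measurable_expRN r)).
  by apply: measurableT_comp; [exact: fine_measurable|exact: (measurable_stopping_time DX st)].
exact: (measurableT_comp mpsi (measurable_Xtau DX st)).
Qed.

(* Started inside [S], the process can only reach [~` S] through the boundary,
   where the positive and negative parts of [f] outside [S] have the same potential. *)
Lemma reward_inside x : S x -> potential fS x = (g x)%:E.
Proof.
move=> Sx; have [ix|nix] := pselect (interior S x); last first.
  by apply: g_boundary; split => //; exact: subset_closure.
have mSC := measurableC mS.
suff pm : potential fp x = potential fm x.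
  have [_ _ _ [_ fin] _] := green_split x.
  have pm0 := eq_fin_num_sube0 pm fin.
  exact: (esym (etrans (gE x) (etrans (congr1 (adde _) pm0) (adde0 _)))).
pose h := hitting_time X (~` S).
have st : stopping_time X P h := diffusion_hitting DX mSC.
have fpS y : ~ (~` S) y -> fp y = 0 by move=> nSy; rewrite /fp patchE memNset.
have fmS y : ~ (~` S) y -> fm y = 0 by move=> nSy; rewrite /fm patchE memNset.
(* Both parts vanish on [S], so their potentials at [x] are determined by their values at the
   hitting point of the complement. *)
apply: (etrans (esym (potential_hitting x mSC mfp fp0 fpS))).
apply: (etrans _ (potential_hitting x mSC mfm fm0 fmS)).
have mint phi : measurable_fun setT phi -> (forall y, 0 <= phi y) ->
    measurable_fun [set w | h w < +oo] (fun w => (expR (- (r * fine (h w))))%:E *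
      potential phi (X (fine (h w)) w)).
  move=> mphi phi0; apply: (@measurable_stopped_reward (potential phi) h st).
  exact: measurable_potential.
have int0 phi w : (forall y, 0 <= phi y) -> 0 <= (expR (- (r * fine (h w))))%:E *
    potential phi (X (fine (h w)) w).
  by move=> phi0; rewrite mule_ge0 ?lee_fin ?expR_ge0//; exact: potential_ge0.
apply: ge0_ae_eq_integral.
- exact: (measurable_stopping_lty DX st).
- exact: mint.
- exact: mint.
- by move=> w _; exact: int0.
- by move=> w _; exact: int0.
have mX0 : measurable [set w | X 0 w = x].
  have cx : closed [set x] by apply: accessible_closed_set1;
    exact/hausdorff_accessible/norm_hausdorff.
  rewrite -[X in measurable X]setTI.
  exact: (measurable_X DX (lexx 0%R) measurableT (closed_measurable_euclid cx)).
(* Paths start at [x] only almost surely; the exceptional event is discarded. *)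
exists (~` [set w | X 0 w = x]); split; first exact: measurableC.
  apply: (etrans (probability_setC (P x) mX0)).
  by apply: (etrans (congr1 (fun z => 1 - z) (diffusion_start DX x))); rewrite subee.
move=> w /=; apply: contra_not => X0x hfin; congr (_ * _).
set h0 := fine (h w).
have h00 : (0 <= h0)%R by exact: (fine_stopping_ge0 w st).
have hE : h w = h0%:E by rewrite fineK// ge0_fin_numE//; exact: st.1.
have inS t : (0 <= t)%R -> (t < h0)%R -> S (X t w).
  move=> t0 th; apply: contrapT.
  by apply: (hitting_time_gt (C := ~` S) t0); rewrite -/h hE lte_fin.
have bX : boundary S (X h0 w).
  split; last first.
    by have := closure_hitting DX hE h00; rewrite closure_setC.
  (* At time 0 the path is at [x], a point of [S]; a later hitting point is a left limit of points
     of [S]. *)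
  have [h0eq|h0gt] := eqVneq h0 0%R.
    by rewrite h0eq X0x; exact: subset_closure.
  by apply: (closure_before DX) => //; rewrite lt_neqAle eq_sym h0gt.
(* On the boundary [g] is the potential of [fS], so [gE] forces the other two potentials to
   agree. *)
have := gE (X h0 w); rewrite -(g_boundary bX).
have [_ Sfin _ [pfin mfin] _] := green_split (X h0 w).
exact: fin_num_addB_eq.
Qed.

Let g_le x : (g x)%:E <= potential fS x.
Proof. by have [/reward_inside->//|] := pselect (S x); exact: g_outside. Qed.

Let fS_fin x : potential fS x < +oo.
Proof. by have [_ + _ _ _] := green_split x; rewrite fin_numElt => /andP[]. Qed.

Lemma expected_reward_le tau x : stopping_time X P tau ->
  expected_reward X P r g tau x <= potential fS x.
Proof.
move=> st; rewrite (expected_reward_finite DX r_gt0 x mfS fS0 g_ge0 g_cont g_le fS_fin st).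
apply: le_trans (stopped_potential_le DX r_gt0 mfS fS0 x st).
apply: ge0_le_integral.
- exact: (measurable_stopping_lty DX st).
- by move=> w _; rewrite mule_ge0// lee_fin ?expR_ge0.
- apply: (@measurable_stopped_reward (EFin \o g) tau st).
  by apply/measurable_EFinP; exact: continuous_measurable_euclid.
- apply: (@measurable_stopped_reward (potential fS) tau st).
  exact: measurable_potential.
- by move=> w _; rewrite lee_wpmul2l// lee_fin expR_ge0.
Qed.

(** At a finite hitting time the process is in the closure of [S]: in [S] itself [reward_inside]
    applies, otherwise the boundary condition. As [fS] vanishes off [S], [potential_hitting] gives
    equality. *)
Lemma expected_reward_hitting x :
  expected_reward X P r g (hitting_time X S) x = potential fS x.
Proof.
have st := diffusion_hitting DX mS.
rewrite (expected_reward_finite DX r_gt0 x mfS fS0 g_ge0 g_cont g_le fS_fin st).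
have fSS y : ~ S y -> fS y = 0 by move=> nSy; rewrite /fS patchE memNset.
apply: (etrans _ (potential_hitting x mS mfS fS0 fSS)).
apply: eq_integral => w; rewrite inE/= => hfin; congr (_ * _).
set h0 := fine _.
have h00 : (0 <= h0)%R by exact: (fine_stopping_ge0 w st).
have hE : hitting_time X S w = h0%:E by rewrite fineK// ge0_fin_numE//; exact: st.1.
have cX := closure_hitting DX hE h00.
have [SX|nSX] := pselect (S (X h0 w)); first by rewrite reward_inside.
by rewrite g_boundary//; split => // /interior_subset.
Qed.

End green_optimal_stopping.
Unset Implicit Arguments.
Set Strict Implicit.
Set Printing Implicit Defensive.

Theorem theorem2p3 (R : realType) (d : nat)
    (dO : measure_display) (Omega : measurableType dO)
    (X : R -> Omega -> euclid R d) (P : euclid R d -> probability Omega R)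
    (X_diffusion : diffusion X P)
    (r : R) (r_gt0 : 0 < r)
    (g : euclid R d -> R) (g_ge0 : forall x, 0 <= g x) (g_cont : continuous g)
    (f : euclid R d -> R) (f_meas : measurable_fun [set: euclid R d] f)
    (f_int : forall x, (green X P r x).-integrable setT (fun y => (f y)%:E))
    (g_green : forall x, (g x)%:E = (\int[green X P r x]_y (f y)%:E)%E)
    (S : set (euclid R d)) (S_borel : measurable S)
    (f_ge0 : forall x, S x -> 0 <= f x) :
  let Vtilde := fun x => fine (\int[green X P r x]_(y in S) (f y)%:E)%E in
  ((forall x, boundary S x -> Vtilde x = g x) <->
   (forall x, boundary S x ->
      (\int[green X P r x]_(y in ~` S) (f y)%:E = 0)%E)) /\
  ((forall x, ~ S x -> g x <= Vtilde x) ->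
   (forall x, boundary S x -> Vtilde x = g x) ->
   optimal X P r g (hitting_time X S) /\
   (forall x, (Vtilde x)%:E = value_function X P r g x /\
      value_function X P r g x
        = expected_reward X P r g (hitting_time X S) x)).
Proof.
move=> Vtilde.
pose pS := potential X P r ((EFin \o f) \_ S).
have split x := green_split X_diffusion f_meas f_int S_borel f_ge0 x.
have VE x : (Vtilde x)%:E = pS x.
  by have [HS Sfin _ _ _] := split x; rewrite /Vtilde HS fineK.
(* This decomposition gives the equivalence of the two boundary conditions, by cancelling the finite
   [Vtilde x]. *)
have gE x : (g x)%:E = ((Vtilde x)%:E + \int[green X P r x]_(y in ~` S) (f y)%:E)%E.
  by rewrite g_green; have [_ _ -> _ ->] := split x; rewrite VE.
split.
  split=> h x bx; last by apply: EFin_inj; rewrite gE h// adde0.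
  have [_ _ HC [pfin mfin] _] := split x; have := gE x; rewrite -h// HC.
  have Vfin : (Vtilde x)%:E \is a fin_num by [].
  by move=> e; exact: (eq_fin_num_sube0 (fin_num_addB_eq Vfin pfin mfin e) mfin).
move=> g_out g_bd.
have st := diffusion_hitting X_diffusion S_borel.
have g_bd' x : boundary S x -> pS x = (g x)%:E by move=> bx; rewrite -VE g_bd.
have g_out' x : ~ S x -> ((g x)%:E <= pS x)%E by move=> nSx; rewrite -VE lee_fin g_out.
have hit x : expected_reward X P r g (hitting_time X S) x = pS x.
  exact: (expected_reward_hitting X_diffusion r_gt0 f_meas f_int S_borel f_ge0
    g_ge0 g_cont g_green g_bd' g_out').
(* Every expected reward is bounded by [pS x], and the hitting time attains the bound. *)
have valE x : value_function X P r g x = pS x.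
  apply/eqP; rewrite eq_le; apply/andP; split.
    apply: ge_ereal_sup => _ [tau sttau <-].
    exact: (expected_reward_le X_diffusion r_gt0 f_meas f_int S_borel f_ge0
      g_ge0 g_cont g_green g_bd' g_out').
  by apply: ereal_sup_ubound; exists (hitting_time X S).
by split; [split => // x|move=> x; split]; rewrite ?VE ?hit ?valE.
Qed.
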